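(* Let $C\in\mathcal{D}_s(Y)$ be $Y$-substantial and contain only connected graphs. Then $$\langle\exp(C)\rangle=\exp\left(\sum_{j=1}^{\infty}\frac{1}{j!}\,\langle C^j\rangle_c\right).$$
   Context: $\mathcal{D}(Y)$ is the algebra of formal power series, with coefficients in $\mathbb{Q}$, of (finite) uni-trivalent graphs whose univalent vertices are coloured by elements of a set $Y$ and whose trivalent vertices are oriented (each has a cyclic order of incident edges); the series are with respect to the grading by number of vertices. The commutative multiplication is disjoint union, the unit is the empty graph $\emptyset$, and $Y=\emptyset$ is allowed (then only trivalent graphs occur). No relations are imposed on the graphs. An element is connected if all its summands are (non-empty) connected graphs. A strut is a graph consisting of a single edge with two univalent ends; $D\in\mathcal{D}(Y)$ is $Y$-substantial if it contains no struts, and $\mathcal{D}_s(Y)$ is the subalgebra of $Y$-substantial elements. For $D\in\mathcal{D}_s(Y)$, $\langle D\rangle\in\mathcal{D}(\emptyset)$ is defined linearly as the sum of all ways of identifying pairwise all of the $y$-coloured univalent vertices of $D$, for all $y\in Y$ (when two univalent vertices are identified, their two edges are joined into one edge); it is zero if the graph has an odd number of $y$-coloured vertices for some $y\in Y$. $\langle D\rangle_c$ is the connected part of $\langle D\rangle$. $\exp$ is the exponential power series with respect to disjoint union. *)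

(* Defs.v *)
From HB Require Import structures.
From mathcomp Require Import all_boot all_order all_algebra.
From mathcomp Require Import mathcomp_extra boolp classical_sets functions.
From mathcomp Require Import cardinality fsbigop.

Set Implicit Arguments.
Unset Strict Implicit.
Unset Printing Implicit Defensive.

Import Order.TTheory GRing.Theory Num.Theory.

Local Open Scope classical_set_scope.
Local Open Scope ring_scope.

(* A Y-coloured vertex-oriented uni-trivalent graph, given by its finite set H
   of half-edges.  The edges are the orbits of the fixed-point-free involution
   [edge].  The vertices are the orbits of [vrot], which have size 1 (univalent
   vertices) or 3 (trivalent vertices); on an orbit of size 3, [vrot] is the
   cyclic order of the incident half-edges.  Exactly the univalent vertices
   carry a colour.  Loops and multiple edges are allowed; edges without
   vertices (circles) are not. *)
Record utgraph (Y : Type) (H : finType) := UTGraph {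
  vrot : H -> H;
  edge : H -> H;
  colour : H -> option Y;
  vrot3 : forall h, vrot (vrot (vrot h)) = h;
  edgeK : involutive edge;
  edge_neq : forall h, edge h != h;
  colourE : forall h, isSome (colour h) = (vrot h == h)
}.

Section Graphs.
Context {Y : Type}.
Implicit Types H : finType.

Definition univalent H (G : utgraph Y H) : pred H := fun h => vrot G h == h.

Definition nverts H (G : utgraph Y H) : nat := fcard (vrot G) H.

(* Every vertex carries a half-edge, so connectedness can be tested on
   half-edges.  The empty graph is not connected. *)
Definition gconnected H (G : utgraph Y H) : bool :=
  (0 < #|H|)%N &&
  [forall h, forall k,
     connect [rel x y | (vrot G x == y) || (edge G x == y)] h k].

Definition strut_free H (G : utgraph Y H) : bool :=
  [forall h, univalent G h ==> ~~ univalent G (edge G h)].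

Definition giso H1 H2 (G1 : utgraph Y H1) (G2 : utgraph Y H2) : Prop :=
  exists f : H1 -> H2,
    [/\ bijective f,
        forall h, f (vrot G1 h) = vrot G2 (f h),
        forall h, f (edge G1 h) = edge G2 (f h) &
        forall h, colour G2 (f h) = colour G1 h].

Lemma giso_refl H (G : utgraph Y H) : giso G G.
Proof. by exists id; split=> //; exists id. Qed.

Lemma giso_sym H1 H2 (G1 : utgraph Y H1) (G2 : utgraph Y H2) :
  giso G1 G2 -> giso G2 G1.
Proof.
move=> [f [[g fK gK] fv fe fc]]; exists g; split.
- by exists f.
- by move=> h; rewrite -{1}(gK h) -fv fK.
- by move=> h; rewrite -{1}(gK h) -fe fK.
- by move=> h; rewrite -fc gK.
Qed.

Lemma giso_trans H1 H2 H3 (G1 : utgraph Y H1) (G2 : utgraph Y H2)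
    (G3 : utgraph Y H3) : giso G1 G2 -> giso G2 G3 -> giso G1 G3.
Proof.
move=> [f [fb fv fe fc]] [g [gb gv ge gc]]; exists (g \o f); split=> /=.
- exact: bij_comp.
- by move=> h; rewrite fv gv.
- by move=> h; rewrite fe ge.
- by move=> h; rewrite gc fc.
Qed.

Lemma relabel_vrot3 H (G : utgraph Y H) (i : 'I_#|H|) :
  let r i := enum_rank (vrot G (enum_val i)) in r (r (r i)) = i.
Proof. by rewrite /= !enum_rankK vrot3 enum_valK. Qed.

Lemma relabel_edgeK H (G : utgraph Y H) :
  involutive (fun i : 'I_#|H| => enum_rank (edge G (enum_val i))).
Proof. by move=> i; rewrite enum_rankK edgeK enum_valK. Qed.

Lemma relabel_edge_neq H (G : utgraph Y H) (i : 'I_#|H|) :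
  enum_rank (edge G (enum_val i)) != i.
Proof. by rewrite (can2_eq enum_rankK enum_valK) edge_neq. Qed.

Lemma relabel_colourE H (G : utgraph Y H) (i : 'I_#|H|) :
  isSome (colour G (enum_val i)) = (enum_rank (vrot G (enum_val i)) == i).
Proof. by rewrite (can2_eq enum_rankK enum_valK) colourE. Qed.

Definition relabel H (G : utgraph Y H) : utgraph Y 'I_#|H| :=
  UTGraph (relabel_vrot3 G) (relabel_edgeK G) (relabel_edge_neq G)
    (relabel_colourE G).

Lemma empty_colourE (h : void) :
  isSome (of_void (option Y) h) = (of_void void h == h).
Proof. by case: h. Qed.

Definition gempty : utgraph Y void :=
  @UTGraph Y void (of_void void) (of_void void) (of_void (option Y))
    (fun h => match h with end) (fun h => match h with end)
    (fun h => match h with end) empty_colourE.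

Section Union.
Variables (H1 H2 : finType) (G1 : utgraph Y H1) (G2 : utgraph Y H2).

Definition union_vrot (h : H1 + H2) : H1 + H2 :=
  match h with inl x => inl (vrot G1 x) | inr x => inr (vrot G2 x) end.
Definition union_edge (h : H1 + H2) : H1 + H2 :=
  match h with inl x => inl (edge G1 x) | inr x => inr (edge G2 x) end.
Definition union_colour (h : H1 + H2) : option Y :=
  match h with inl x => colour G1 x | inr x => colour G2 x end.

Lemma union_vrot3 h : union_vrot (union_vrot (union_vrot h)) = h.
Proof. by case: h => h /=; rewrite vrot3. Qed.
Lemma union_edgeK : involutive union_edge.
Proof. by case=> h /=; rewrite edgeK. Qed.
Lemma union_edge_neq h : union_edge h != h.
Proof. by case: h => h; [exact: (edge_neq G1) | exact: (edge_neq G2)]. Qed.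
Lemma union_colourE h : isSome (union_colour h) = (union_vrot h == h).
Proof. by case: h => h; [exact: (colourE G1) | exact: (colourE G2)]. Qed.

Definition gunion : utgraph Y (H1 + H2)%type :=
  UTGraph union_vrot3 union_edgeK union_edge_neq union_colourE.

End Union.

Section Glue.
Variables (H : finType) (G : utgraph Y H).

Definition leg := {h : H | univalent G h}.
Definition inner := {h : H | ~~ univalent G h}.

(* a way of identifying pairwise all univalent vertices of equal colours *)
Definition is_pairing (m : {ffun leg -> leg}) : bool :=
  [forall l, [&& m (m l) == l, m l != l &
                 `[< colour G (val (m l)) = colour G (val l) >]]].

Definition pairing := {m : {ffun leg -> leg} | is_pairing m}.

Lemma pairingK (m : pairing) : involutive (val m).
Proof. by move=> l; have /forallP/(_ l)/and3P[/eqP] := valP m. Qed.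

Lemma pairing_neq (m : pairing) l : val m l != l.
Proof. by have /forallP/(_ l)/and3P[] := valP m. Qed.

(* The half-edge h stays attached to [edge h], unless the latter is a leg l:
   then the edge of l is prolonged by the edge of the leg paired with l. *)
Definition glue_other (m : pairing) (h : H) : H :=
  if insub (edge G h) is Some l then edge G (val (val m l)) else edge G h.

Hypothesis ns : strut_free G.

Lemma glue_other_inner (m : pairing) (h : inner) :
  ~~ univalent G (glue_other m (val h)).
Proof.
rewrite /glue_other; case: insubP => [l _ _ | //].
by have /forallP/(_ (val (val m l)))/implyP := ns; apply; exact: valP.
Qed.

Lemma glue_vrot_inner (h : inner) : ~~ univalent G (vrot G (val h)).
Proof.
apply: contra (valP h) => /eqP e; rewrite /univalent.
by rewrite -{2}(vrot3 G (val h)) !e.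
Qed.

Definition glue_vrot (h : inner) : inner :=
  exist (fun x => ~~ univalent G x) _ (glue_vrot_inner h).
Definition glue_edge m (h : inner) : inner :=
  exist (fun x => ~~ univalent G x) _ (glue_other_inner m h).

Lemma glue_vrot3 h : glue_vrot (glue_vrot (glue_vrot h)) = h.
Proof. by apply: val_inj; rewrite /= vrot3. Qed.

Lemma glue_edgeK m : involutive (glue_edge m).
Proof.
move=> h; apply: val_inj; rewrite /= /glue_other.
case: (insubP _ (edge G (val h))) => [l _ lE | nl].
  rewrite edgeK; case: insubP => [l' _ /val_inj -> | /negP[]]; last exact: valP.
  by rewrite pairingK lE edgeK.
by rewrite edgeK; case: insubP => // l' ul; rewrite (negPf (valP h)) in ul.
Qed.

Lemma glue_edge_neq m h : glue_edge m h != h.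
Proof.
apply/eqP => /(congr1 val); rewrite /= /glue_other.
case: insubP => [l _ lE | nl /eqP]; last by rewrite (negPf (edge_neq _ _)).
move=> /(canRL (edgeK G)); rewrite -lE => /val_inj/eqP.
by rewrite (negPf (pairing_neq _ _)).
Qed.

Lemma glue_colourE h : isSome (@None void) = (glue_vrot h == h).
Proof.
by apply/esym/negbTE; rewrite -val_eqE; exact: (valP h).
Qed.

Definition glue (m : pairing) : utgraph void inner :=
  @UTGraph void inner glue_vrot (glue_edge m) (fun=> None)
    glue_vrot3 (glue_edgeK m) (glue_edge_neq m) glue_colourE.

End Glue.

End Graphs.

(* Isomorphism classes, as a quotient of the graphs on the half-edge sets
   'I_n. *)
Record ordgraph (Y : Type) := OrdGraph {
  nhalf : nat;
  ordgraph_val :> utgraph Y 'I_nhalf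
}.
HB.instance Definition _ Y := gen_eqMixin (ordgraph Y).
HB.instance Definition _ Y := gen_choiceMixin (ordgraph Y).

Definition ordgraph_iso Y : rel (ordgraph Y) := fun G1 G2 => `[< giso G1 G2 >].

Lemma ordgraph_iso_refl Y : reflexive (@ordgraph_iso Y).
Proof. by move=> G; apply/asboolP; exact: giso_refl. Qed.
Lemma ordgraph_iso_sym Y : symmetric (@ordgraph_iso Y).
Proof. by move=> G1 G2; apply/asboolP/asboolP; exact: giso_sym. Qed.
Lemma ordgraph_iso_trans Y : transitive (@ordgraph_iso Y).
Proof.
by move=> G2 G1 G3 /asboolP i /asboolP j; apply/asboolP; exact: giso_trans i j.
Qed.

Canonical ordgraph_iso_equiv Y := EquivRel (@ordgraph_iso Y)
  (@ordgraph_iso_refl Y) (@ordgraph_iso_sym Y) (@ordgraph_iso_trans Y).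

Definition gclass (Y : Type) := {eq_quot (ordgraph_iso_equiv Y)}%qT.
HB.instance Definition _ Y := Choice.on (gclass Y).
HB.instance Definition _ Y := EqQuotient.on (gclass Y).

Definition to_class (Y : Type) (H : finType) (G : utgraph Y H) : gclass Y :=
  \pi_(gclass Y)%qT (OrdGraph (relabel G)).

Definition grepr (Y : Type) (A : gclass Y) : ordgraph Y := repr A.

Section Series.
Variable Y : Type.

Definition cunion (A B : gclass Y) : gclass Y :=
  to_class (gunion (grepr A) (grepr B)).

Definition cconnected (A : gclass Y) : bool := gconnected (grepr A).
Definition cstrut_free (A : gclass Y) : bool := strut_free (grepr A).

(* An element of the graph algebra is given by its coefficients
   f : gclass Y -> rat; in every degree it is a finite linear combination of
   graphs (for infinite Y there are infinitely many graphs in a degree). *)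
Definition is_series (f : gclass Y -> rat) : Prop :=
  forall n, finite_set [set A | nverts (grepr A) = n /\ f A != 0].

Definition substantial (f : gclass Y -> rat) : Prop :=
  forall A, f A != 0 -> cstrut_free A.

Definition connected_series (f : gclass Y -> rat) : Prop :=
  forall A, f A != 0 -> cconnected A.

Definition connected_part (f : gclass Y -> rat) : gclass Y -> rat :=
  fun A => if cconnected A then f A else 0.

Definition series_one : gclass Y -> rat :=
  fun A => (A == to_class gempty)%:R.

(* A graph splits as an ordered disjoint union in finitely many ways. *)
Definition series_mul (f g : gclass Y -> rat) : gclass Y -> rat :=
  fun A => \sum_(p \in [set p : gclass Y * gclass Y | cunion p.1 p.2 = A])
             f p.1 * g p.2.

Definition series_pow (f : gclass Y -> rat) (j : nat) : gclass Y -> rat :=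
  iter j (series_mul f) series_one.

(* For f with zero coefficient at the empty graph, only the powers with
   j <= nverts A contribute to the coefficient of A. *)
Definition series_exp (f : gclass Y -> rat) : gclass Y -> rat :=
  fun A => \sum_(j \in [set: nat]) (j`!%:R)^-1 * series_pow f j A.

(* The closure of a single graph; only used on graphs without struts, the
   value on other graphs being a dummy. *)
Definition bracket_graph (A : gclass Y) : gclass void -> rat :=
  match @idP (cstrut_free A) with
  | ReflectT ns => fun K =>
      \sum_(m : pairing (grepr A)) (to_class (glue ns m) == K)%:R
  | ReflectF _ => fun=> 0
  end.

(* For a substantial series the sum is finite: the univalent vertices of a
   graph without struts number at most three times its trivalent vertices,
   and the latter are the vertices of its closures. *)
Definition bracket (f : gclass Y -> rat) : gclass void -> rat :=
  fun K => \sum_(A \in [set: gclass Y]) f A * bracket_graph A K.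

End Series.

(* Main.v *)
(* Count graphs on labelled half-edges. For half-edge data S on a finite set
   T and U a subset of T, let [hat S f U] be the sum over the graphs A of
   f(A) times the number of embeddings of A onto U. Disjoint union becomes
   subset convolution: [hat S (f * g) V] is the sum over U in V of
   [hat S f U * hat S g (V \ U)]. If f is connected, the generating polynomial of
   the numbers [hat S (f^j) V / j!] is therefore multiplicative over
   disjoint unions of closed sets (both sides have the same derivative), and
   so is [hat S (exp f)]. Conversely, a multiplicative function is
   determined by its values on connected sets, where exp f and f agree.

   A gluing of A that yields a trivalent graph K is the same as a way s of
   cutting some edges of K and colouring the new ends, together with an
   isomorphism of A with the cut graph; so [hat K <f>] is the sum over s of
   the [hat] of f on K cut along s. Cutting is independent on disjoint parts
   of K, hence the bracket of exp C is multiplicative as well, and it is the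
   exponential of its connected part, which is the sum of the connected
   parts of the brackets of C^j / j!. *)
Require Import Defs.
From mathcomp Require Import all_boot all_order all_algebra.
From mathcomp Require Import mathcomp_extra boolp classical_sets functions.
From mathcomp Require Import cardinality fsbigop.

Set Implicit Arguments.
Unset Strict Implicit.
Unset Printing Implicit Defensive.

Import Order.TTheory GRing.Theory Num.Theory.

Local Open Scope ring_scope.

(** * Isomorphism classes and embeddings *)

Lemma relabel_giso (Y : Type) (H : finType) (G : utgraph Y H) :
  giso G (relabel G).
Proof.
exists enum_rank; split=> [|h|h|h] /=.
- by exists enum_val; [exact: enum_rankK | exact: enum_valK].
- by rewrite enum_rankK.
- by rewrite enum_rankK.
- by rewrite enum_rankK.
Qed.

Lemma ordgraph_class_giso (Y : Type) (G1 G2 : ordgraph Y) :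
  \pi_(gclass Y)%qT G1 = \pi_(gclass Y)%qT G2 <-> giso G1 G2.
Proof.
split=> [/eqP|i]; first by rewrite (eqmodE (ordgraph_iso_equiv Y)) => /asboolP.
by apply/eqP; rewrite (eqmodE (ordgraph_iso_equiv Y)); apply/asboolP.
Qed.

Lemma to_class_giso (Y : Type) (H1 H2 : finType) (G1 : utgraph Y H1)
    (G2 : utgraph Y H2) : to_class G1 = to_class G2 <-> giso G1 G2.
Proof.
rewrite ordgraph_class_giso /=; split=> i.
  apply: giso_trans (relabel_giso G1) _; apply: giso_trans i _.
  exact: giso_sym (relabel_giso G2).
apply: giso_trans (giso_sym (relabel_giso G1)) _; apply: giso_trans i _.
exact: relabel_giso.
Qed.

Lemma to_class_repr (Y : Type) (A : gclass Y) : to_class (grepr A) = A.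
Proof.
rewrite -[RHS]reprK; apply/ordgraph_class_giso => /=.
exact: giso_sym (relabel_giso _).
Qed.

Lemma repr_to_class (Y : Type) (H : finType) (G : utgraph Y H) :
  giso (grepr (to_class G)) G.
Proof. by apply/to_class_giso; rewrite to_class_repr. Qed.

Lemma giso_card (Y : Type) (H1 H2 : finType) (G1 : utgraph Y H1)
    (G2 : utgraph Y H2) : giso G1 G2 -> #|H1| = #|H2|.
Proof. by case=> f [fb _ _ _]; exact: bij_eq_card fb. Qed.

(* Half-edge data without any axiom: only the part of it that is hit by a graph
   matters in [emb] below, so that all parts of a graph, and all ways of cutting
   it, live on one and the same half-edge set. *)
Record hdata (Y : Type) (T : Type) := HData {
  hvrot : T -> T;
  hedge : T -> T;
  hcolour : T -> option Y
}.

Definition data_of (Y : Type) (H : finType) (G : utgraph Y H) : hdata Y H :=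
  HData (vrot G) (edge G) (colour G).

Section Embeddings.
Variables (Y : Type) (T : finType) (S : hdata Y T).
Implicit Types (H : finType) (U V : {set T}).

Definition emb_spec H (G : utgraph Y H) U (f : {ffun H -> T}) : Prop :=
  [/\ injective f, f @: [set: H] = U,
      forall h, f (vrot G h) = hvrot S (f h),
      forall h, f (edge G h) = hedge S (f h) &
      forall h, hcolour S (f h) = colour G h].

Definition emb H (G : utgraph Y H) U : {set {ffun H -> T}} :=
  [set f : {ffun H -> T} | `[< emb_spec G U f >]].

Lemma embP H (G : utgraph Y H) U f : reflect (emb_spec G U f) (f \in emb G U).
Proof. by rewrite inE; exact: asboolP. Qed.

Lemma emb_card H (G : utgraph Y H) U f : f \in emb G U -> #|H| = #|U|.
Proof. by move=> /embP[fi <- _ _ _]; rewrite card_imset // cardsT. Qed.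

Lemma card_emb_le H1 H2 (G1 : utgraph Y H1) (G2 : utgraph Y H2) U :
  giso G1 G2 -> (#|emb G2 U| <= #|emb G1 U|)%N.
Proof.
move=> [f [[g fK gK] fv fe fc]].
rewrite -(@card_in_imset _ _ (fun p : {ffun H2 -> T} => [ffun h => p (f h)])).
  apply/subset_leq_card/fintype.subsetP => q.
  case/imsetP=> p /embP[pi pU pv pe pc] ->.
  apply/embP; split=> [x y|||h|h]; rewrite ?ffunE ?fv ?fe //.
  - by move/pi/(can_inj fK).
  - rewrite -pU; apply/setP => t; apply/imsetP/imsetP => -[h _ ->].
      by exists (f h); rewrite ?ffunE.
    by exists (g h); rewrite ?ffunE ?gK.
  - by move=> h; rewrite !ffunE fv.
  - by rewrite pc fc.
move=> p q _ _ /ffunP pq; apply/ffunP => h.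
by have := pq (g h); rewrite !ffunE gK.
Qed.

Lemma card_emb_giso H1 H2 (G1 : utgraph Y H1) (G2 : utgraph Y H2) U :
  giso G1 G2 -> #|emb G1 U| = #|emb G2 U|.
Proof.
by move=> i; apply/eqP; rewrite eqn_leq !card_emb_le //; exact: giso_sym.
Qed.

(** Both embeddings read the graph structure off [S] on the same image, so the first followed by the
    inverse of the second is an isomorphism. *)
Lemma emb_giso H1 H2 (G1 : utgraph Y H1) (G2 : utgraph Y H2) U f1 f2 :
  f1 \in emb G1 U -> f2 \in emb G2 U -> giso G1 G2.
Proof.
move=> F1 F2; have := emb_card F1; rewrite -(emb_card F2) => cE.
move/embP: F1 => [i1 U1 v1 e1 c1]; move/embP: F2 => [i2 U2 v2 e2 c2].
have /choice[g gE] (h : H1) : exists k, f2 k = f1 h.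
  have : f1 h \in U by rewrite -U1 imset_f.
  by rewrite -U2 => /imsetP[k _ ->]; exists k.
exists g; split=> [|h|h|h].
- apply: inj_card_bij; last by rewrite cE.
  by move=> x y gxy; apply: i1; rewrite -!gE gxy.
- by apply: i2; rewrite v2 !gE v1.
- by apply: i2; rewrite e2 !gE e1.
- by rewrite -c2 gE c1.
Qed.

Lemma emb_closed H (G : utgraph Y H) U f t : f \in emb G U -> t \in U ->
  (hvrot S t \in U) && (hedge S t \in U).
Proof.
move=> /embP[_ <- v e _] /imsetP[h _ ->]; rewrite -v -e.
by rewrite !imset_f.
Qed.

Lemma emb_gempty U : #|emb gempty U| = (U == finset.set0).
Proof.
have [->|/set0Pn[t tU]] := eqVneq.
  rewrite -[true : nat](cards1 [ffun h : void => of_void T h]).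
  apply: eq_card => f; rewrite [in RHS]inE.
  rewrite (_ : f = [ffun h => of_void T h]) ?eqxx; last first.
    by apply/ffunP; case.
  apply/embP; split; try by case.
  by apply/setP => t; rewrite inE; apply/imsetP => -[[]].
apply/eqP; rewrite cards_eq0; apply/eqP/setP => f; rewrite [in RHS]inE.
by apply/embP => -[_ UE]; move: tU; rewrite -UE => /imsetP[[]].
Qed.

(** An embedding of the union amounts to the image U of the first summand and an embedding of each
    summand, the second one onto what U leaves of V. *)
Lemma card_emb_gunion H1 H2 (G1 : utgraph Y H1) (G2 : utgraph Y H2) V :
  #|emb (gunion G1 G2) V| =
  (\sum_(U : {set T} | U \subset V) #|emb G1 U| * #|emb G2 (V :\: U)|)%N.
Proof.
pose l (f : {ffun H1 + H2 -> T}) : {ffun H1 -> T} := [ffun h => f (inl h)].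
pose r (f : {ffun H1 + H2 -> T}) : {ffun H2 -> T} := [ffun h => f (inr h)].
pose join (p : {ffun H1 -> T} * {ffun H2 -> T}) : {ffun H1 + H2 -> T} :=
  [ffun h => match h with inl x => p.1 x | inr x => p.2 x end].
have joinl p : l (join p) = p.1 by apply/ffunP => h; rewrite !ffunE.
have joinr p : r (join p) = p.2 by apply/ffunP => h; rewrite !ffunE.
rewrite -sum1_card (partition_big (fun f => l f @: [set: H1])
  (fun U => U \subset V)) /=; last first.
  move=> f /embP[_ <- _ _ _]; apply/fintype.subsetP => _ /imsetP[h _ ->].
  by rewrite ffunE imset_f.
apply: eq_bigr => U UV; rewrite sum1_card -cardsX.
rewrite -(@card_in_imset _ _ join); last first.
  move=> [p q] [p' q'] _ _ pq.
  have := joinr (p, q); have := joinl (p, q).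
  by rewrite pq joinl joinr /= => -> ->.
apply: eq_card => f; rewrite [LHS]inE; apply/andP/imsetP.
  case=> /embP[fi fV fv fe fc] /eqP fU; exists (l f, r f); last first.
    by apply/ffunP; case=> h; rewrite !ffunE.
  rewrite inE; apply/andP; split; apply/embP; split=> //.
  - by move=> x y; rewrite !ffunE => /fi[].
  - by move=> h; rewrite !ffunE -fv.
  - by move=> h; rewrite !ffunE -fe.
  - by move=> h; rewrite !ffunE fc.
  - by move=> x y; rewrite !ffunE => /fi[].
  - rewrite -fV -fU; apply/setP => t; rewrite inE; apply/imsetP/andP.
      case=> h _ ->; rewrite ffunE imset_f //; split=> //.
      by apply/imsetP => -[k _]; rewrite ffunE => /fi.
    move=> [nl /imsetP[[] h _ tE]]; last by exists h; rewrite ?ffunE.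
    by case/negP: nl; apply/imsetP; exists h; rewrite ?ffunE.
  - by move=> h; rewrite !ffunE -fv.
  - by move=> h; rewrite !ffunE -fe.
  - by move=> h; rewrite !ffunE fc.
move=> [[p q]]; rewrite inE /= => /andP[].
move=> /embP[pi pU pv pe pc] /embP[qi qU qv qe qc] ->; split; last first.
  by rewrite joinl pU.
apply/embP; split.
- move=> [] x [] y; rewrite !ffunE /= => xy;
    rewrite ?(pi _ _ xy) ?(qi _ _ xy) //.
    have : q y \in V :\: U by rewrite -qU imset_f.
    by rewrite -xy -pU inE imset_f.
  have : q x \in V :\: U by rewrite -qU imset_f.
  by rewrite xy -pU inE imset_f.
- apply/setP => t; apply/imsetP/idP.
    case=> -[] h _ ->; rewrite ffunE /=.
      by apply: (fintype.subsetP UV); rewrite -pU imset_f.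
    have : q h \in V :\: U by rewrite -qU imset_f.
    by rewrite inE => /andP[].
  move=> tV; have [tU|tU] := boolP (t \in U).
    move: tU; rewrite -pU => /imsetP[h _ ->]; exists (inl h) => //.
    by rewrite ffunE.
  have : t \in V :\: U by rewrite inE tU.
  rewrite -qU => /imsetP[h _ ->]; exists (inr h) => //.
  by rewrite ffunE.
- by case=> h; rewrite !ffunE /= ?pv ?qv.
- by case=> h; rewrite !ffunE /= ?pe ?qe.
- by case=> h; rewrite !ffunE /= ?pc ?qc.
Qed.

End Embeddings.

(** * Embedding counts of a series *)

Section Hat.
Variables (Y : Type) (T : finType) (S : hdata Y T).
Implicit Types (f g : gclass Y -> rat) (U V : {set T}).

Definition nemb (A : gclass Y) U : nat := #|emb S (grepr A) U|.

(* At most one isomorphism class of graphs embeds onto U, so that this is a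
   coefficient of f multiplied by the number of automorphisms of a graph. *)
Definition hat f U : rat :=
  \sum_(A \in [set: gclass Y]%classic) f A * (nemb A U)%:R.

Lemma card_emb_class H (G : utgraph Y H) U :
  nemb (to_class G) U = #|emb S G U|.
Proof. exact/card_emb_giso/repr_to_class. Qed.

Lemma emb_class (A B : gclass Y) U :
  (0 < nemb A U)%N -> (0 < nemb B U)%N -> A = B.
Proof.
rewrite /nemb => /card_gt0P[x xA] /card_gt0P[y yB].
rewrite -(to_class_repr A) -(to_class_repr B).
by apply/to_class_giso; exact: emb_giso xA yB.
Qed.

Lemma hat_class (A : gclass Y) U f : (0 < nemb A U)%N ->
  hat f U = f A * (nemb A U)%:R.
Proof.
move=> NA.
transitivity (\sum_(B \in [set A]%classic) f B * (nemb B U)%:R);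
  last exact: fsbig_set1.
apply/esym/fsbig_widen => // B [_ /eqP BA] /=.
have [->|NB] := posnP (nemb B U); first by rewrite mulr0.
by case/eqP: BA; exact: emb_class NB NA.
Qed.

(** The class A does not depend on f, so after this case split identities between series reduce to a
    single coefficient, with no finiteness of support assumed. *)
Lemma hat_cases U :
  {A | (0 < nemb A U)%N &
       forall f, hat f U = f A * (nemb A U)%:R} +
  {(forall A, nemb A U = 0%N) /\ (forall f, hat f U = 0)}.
Proof.
have [/cid[A NA]|nA] := pselect (exists A : gclass Y, (0 < nemb A U)%N).
  by left; exists A => // f; exact: hat_class.
have N0 (A : gclass Y) : nemb A U = 0%N.
  by apply/eqP; rewrite -leqn0 leqNgt; apply/negP => NA; apply: nA; exists A.
by right; split=> // f; apply: fsbig1 => A _; rewrite N0 mulr0.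
Qed.

Lemma card_emb_cunion (A B : gclass Y) V :
  nemb (cunion A B) V = (\sum_(U : {set T} | U \subset V)
    nemb A U * nemb B (V :\: U))%N.
Proof. by rewrite card_emb_class card_emb_gunion. Qed.

(** Any splitting of A is visible on V as a subset and its complement, and these two sets determine
    the classes of the parts. *)
Lemma finite_cunion V (A : gclass Y) : (0 < nemb A V)%N ->
  finite_set [set p : gclass Y * gclass Y | cunion p.1 p.2 = A]%classic.
Proof.
(* [cl U] is the only class that can embed onto U, and a dummy if there is none. *)
move=> NA; have /choice[cl clE] U : exists B, forall B',
    (0 < nemb B' U)%N -> B' = B.
  case: (hat_cases U) => [[B NB _]|[N0 _]].
    by exists B => B' NB'; exact: emb_class NB' NB.
  by exists A => B'; rewrite N0.
apply: (@sub_finite_set _ _ ((fun U => (cl U, cl (V :\: U))) @` setT)%classic).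
  move=> [p q] /= pqA; have := NA; rewrite -pqA card_emb_cunion lt0n.
  rewrite sum_nat_eq0 => /forallPn[/= U]; rewrite negb_imply muln_eq0 negb_or.
  by rewrite -!lt0n => /and3P[_ /clE-> /clE->]; exists U.
exact/finite_image/finite_finset.
Qed.

Lemma hat_mul f g V : hat (series_mul f g) V =
  \sum_(U : {set T} | U \subset V) hat f U * hat g (V :\: U).
Proof.
(* If no graph embeds onto V, every term vanishes: the union of graphs on U and on its complement
   would embed onto V. *)
case: (hat_cases V) => [[A NA ->]|[N0 ->]]; last first.
  rewrite big1 // => U UV.
  case: (hat_cases U) => [[A NA _]|[_ ->]]; last by rewrite mul0r.
  case: (hat_cases (V :\: U)) => [[B NB _]|[_ ->]]; last by rewrite mulr0.
  have /eqP := N0 (cunion A B); rewrite card_emb_cunion sum_nat_eq0.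
  by move=> /forallP/(_ U)/implyP/(_ UV); rewrite muln_eq0 !eqn0Ngt NA NB.
pose P := [set p : gclass Y * gclass Y | cunion p.1 p.2 = A]%classic.
pose F (p : gclass Y * gclass Y) U :=
  (f p.1 * (nemb p.1 U)%:R) *
  (g p.2 * (nemb p.2 (V :\: U))%:R).
have Pfin : finite_set P by exact: finite_cunion NA.
rewrite /series_mul mulr_fsuml.
transitivity (\sum_(p \in P) \sum_(U : {set T} | U \subset V) F p U).
  apply: eq_fsbigr => p; rewrite inE => pP.
  rewrite -{1}pP card_emb_cunion natr_sum mulr_sumr.
  by apply: eq_bigr => U _; rewrite natrM mulrACA.
rewrite fsbig_finite // exchange_big /=; apply: eq_bigr => U UV.
rewrite -fsbig_finite //.
case: (hat_cases U) => [[A1 N1 ->]|[N0 ->]]; last first.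
  by rewrite mul0r; apply: fsbig1 => p _; rewrite /F N0 mulr0 mul0r.
case: (hat_cases (V :\: U)) => [[A2 N2 ->]|[N0 ->]]; last first.
  by rewrite mulr0; apply: fsbig1 => p _; rewrite /F N0 !mulr0.
transitivity (\sum_(p \in [set (A1, A2)]%classic) F p U);
  last exact: fsbig_set1.
apply/esym/fsbig_widen.
  move=> _ ->; rewrite /P /=; apply: (emb_class (U := V)) => //.
  rewrite card_emb_cunion (bigD1 U) //= addn_gt0 muln_gt0.
  by rewrite N1 N2.
move=> [B1 B2] [_ nB] /=; rewrite /F /=.
have [->|NB1] := posnP (nemb B1 U); first by rewrite mulr0 mul0r.
have [->|NB2] := posnP (nemb B2 (V :\: U)); first by rewrite !mulr0.
by case: nB; rewrite (emb_class NB1 N1) (emb_class NB2 N2).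
Qed.

Lemma hat_one U : hat (@series_one Y) U = (U == finset.set0)%:R.
Proof.
have NE : nemb (to_class gempty) U = (U == finset.set0).
  by rewrite card_emb_class emb_gempty.
have [U0|U0] := eqVneq U finset.set0.
  have N1 : (0 < nemb (to_class gempty) U)%N by rewrite NE U0 eqxx.
  by rewrite (hat_class _ N1) /series_one NE U0 !eqxx mulr1.
apply: fsbig1 => A _; rewrite /series_one.
by case: eqP => [->|_]; rewrite ?mul0r // NE (negPf U0) mulr0.
Qed.

End Hat.

Lemma emb_refl (Y : Type) (H : finType) (G : utgraph Y H) :
  (0 < #|emb (data_of G) G [set: H]|)%N.
Proof.
apply/card_gt0P; exists [ffun h => h]; apply/embP; split.
- by move=> x y; rewrite !ffunE.
- by apply/setP => t; rewrite inE; apply/imsetP; exists t; rewrite ?ffunE.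
- by move=> h; rewrite !ffunE.
- by move=> h; rewrite !ffunE.
- by move=> h; rewrite !ffunE.
Qed.

(** The coefficient of A is recovered on the half-edges of a representative, onto which A embeds at
    least by the identity, so the factor to cancel is nonzero. *)
Lemma hat_inj (Y : Type) (f g : gclass Y -> rat) :
  (forall (H : finType) (G : utgraph Y H),
     hat (data_of G) f [set: H] = hat (data_of G) g [set: H]) -> f = g.
Proof.
move=> fg; apply: funext => A.
have NA : (0 < nemb (data_of (grepr A)) A [set: _])%N by exact: emb_refl.
have := fg _ (grepr A); rewrite !(hat_class _ NA) => /mulIf; apply.
by rewrite pnatr_eq0 -lt0n.
Qed.

(** * Exponentials *)

Lemma deriv_inj (R : numDomainType) (p q : {poly R}) :
  p^`() = q^`() -> p`_0 = q`_0 -> p = q.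
Proof.
move=> dpq pq0; apply/polyP => -[//|i].
have := congr1 (fun r : {poly R} => r`_i) dpq; rewrite !coef_deriv.
by move/eqP; rewrite -subr_eq0 -mulrnBl mulrn_eq0 /= subr_eq0 => /eqP.
Qed.

Lemma card_setD_lt (T : finType) (U V : {set T}) :
  U \subset V -> U != finset.set0 -> (#|V :\: U| < #|V|)%N.
Proof.
move=> UV U0; rewrite -(cardsID U V) (finset.setIidPr UV).
by rewrite -[ltnLHS]add0n ltn_add2r card_gt0.
Qed.

Section HatExp.
Variables (Y : Type) (T : finType) (S : hdata Y T) (f : gclass Y -> rat).
Hypothesis f0 : f (to_class gempty) = 0.
Implicit Types (U V : {set T}).

Lemma hat_set0 : hat S f finset.set0 = 0.
Proof.
apply: fsbig1 => A _; have [->|NA] := posnP (nemb S A finset.set0).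
  by rewrite mulr0.
suff -> : A = to_class gempty by rewrite f0 mul0r.
by apply: emb_class NA _; rewrite card_emb_class emb_gempty eqxx.
Qed.

Lemma hat_neq0 U : hat S f U != 0 -> U != finset.set0.
Proof. by apply: contra_neq => ->; exact: hat_set0. Qed.

(** Each of the j factors takes up a nonempty part of U, because f vanishes at the empty graph. *)
Lemma hat_pow_eq0 j U : (#|U| < j)%N -> hat S (series_pow f j) U = 0.
Proof.
elim: j U => // j IHj U Uj; rewrite [series_pow _ _]/= hat_mul big1 // => V VU.
have [->|/hat_neq0 V0] := eqVneq (hat S f V) 0; first by rewrite mul0r.
rewrite IHj ?mulr0 // -ltnS.
by apply: leq_trans Uj; rewrite ltnS card_setD_lt.
Qed.

Lemma hat_exp n U : (#|U| < n)%N -> hat S (series_exp f) U =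
  \sum_(j < n) j`!%:R^-1 * hat S (series_pow f j) U.
Proof.
move=> Un; case: (hat_cases S U) => [[A NA hE]|[_ h0]]; last first.
  by rewrite h0 big1 // => j _; rewrite h0 mulr0.
rewrite hE /series_exp mulr_fsuml.
rewrite (fsbig_ord _ n (fun j => j`!%:R^-1 * hat S (series_pow f j) U)).
transitivity (\sum_(j \in [set: nat]%classic)
    j`!%:R^-1 * hat S (series_pow f j) U).
  by apply: eq_fsbigr => j _; rewrite hE mulrA.
apply/esym/fsbig_widen => // j [_ /negP]; rewrite -leqNgt => nj /=.
by rewrite hat_pow_eq0 ?mulr0 // (leq_trans Un).
Qed.

(** The indeterminate marks the number of factors: evaluation at 1 gives the exponential,
    differentiation removes a factor. The cut-off loses no coefficient by [hat_pow_eq0]. *)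
Definition hat_poly U : {poly rat} :=
  \poly_(j < #|U|.+1) (j`!%:R^-1 * hat S (series_pow f j) U).

Lemma coef_hat_poly U j :
  (hat_poly U)`_j = j`!%:R^-1 * hat S (series_pow f j) U.
Proof.
rewrite coef_poly ltnS leqNgt; case: ltnP => //= /hat_pow_eq0->.
by rewrite mulr0.
Qed.

Lemma hat_exp_horner U : hat S (series_exp f) U = (hat_poly U).[1].
Proof.
rewrite horner_poly (hat_exp (ltnSn _)).
by apply: eq_bigr => j _; rewrite expr1n mulr1.
Qed.

Lemma hat_poly0 U : (hat_poly U)`_0 = (U == finset.set0)%:R.
Proof. by rewrite coef_hat_poly invr1 mul1r hat_one. Qed.

(** Splitting off one factor turns the power j + 1 into a sum over U, and (j + 1) / (j + 1)! = 1 /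
    j!. *)
Lemma deriv_hat_poly V : (hat_poly V)^`() =
  \sum_(U : {set T} | U \subset V) hat S f U *: hat_poly (V :\: U).
Proof.
apply/polyP => i; rewrite coef_deriv coef_hat_poly coef_sum.
rewrite [series_pow _ _]/= hat_mul mulr_sumr -sumrMnl; apply: eq_bigr => U _.
rewrite coefZ coef_hat_poly mulrCA -mulrnAr -mulrnAl; congr (_ * (_ * _)).
rewrite factS natrM invfM -[LHS]mulr_natl mulrA divff ?mul1r //.
by rewrite pnatr_eq0.
Qed.

(** Induction on the total size: the constant terms agree, and in the derivative every U that
    contributes lies in exactly one of V1 and V2 and leaves a smaller disjoint pair. *)
Lemma hat_polyU V1 V2 : [disjoint V1 & V2] ->
    (forall U, U \subset V1 :|: V2 -> hat S f U != 0 ->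
      (U \subset V1) || (U \subset V2)) ->
  hat_poly (V1 :|: V2) = hat_poly V1 * hat_poly V2.
Proof.
have [n] := ubnP (#|V1| + #|V2|)%N; elim: n V1 V2 => // n IHn V1 V2.
rewrite ltnS => Vn dV sV; apply: deriv_inj; last first.
  rewrite coefM big_ord1 !hat_poly0 finset.setU_eq0 -natrM mulnb.
  by [].
rewrite derivM !deriv_hat_poly mulr_suml mulr_sumr.
rewrite (big_mkcond (fun U => U \subset V1 :|: V2)).
rewrite (big_mkcond (fun U => U \subset V1)).
rewrite (big_mkcond (fun U => U \subset V2)).
rewrite -big_split /=; apply: eq_bigr => U _.
have [h0|hU] := eqVneq (hat S f U) 0.
  by rewrite h0 !scale0r mul0r mulr0 !if_same addr0.
have U0 := hat_neq0 hU.
have nU12 : ~~ ((U \subset V1) && (U \subset V2)).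
  apply: contra U0 => /andP[U1 U2]; rewrite -finset.subset0.
  by rewrite -(disjoint_setI0 dV) finset.subsetI U1.
have [U1|U1] := boolP (U \subset V1).
  have U2 : ~~ (U \subset V2) by move: nU12; rewrite U1.
  rewrite (negPf U2) addr0 (fintype.subset_trans U1) ?finset.subsetUl //.
  have -> : (V1 :|: V2) :\: U = (V1 :\: U) :|: V2.
    rewrite finset.setDUl; congr (_ :|: _); apply/finset.setDidPl.
    by rewrite disjoint_sym; exact: disjointWl U1 dV.
  rewrite IHn -?scalerAl //.
  - by apply: leq_trans Vn; rewrite ltn_add2r card_setD_lt.
  - exact: disjointWl (finset.subsetDl _ _) dV.
  (* The separation hypothesis is inherited: a W inside V1 has no point in V2, so it avoids U as
     well. *)
  - move=> W /fintype.subsetP WV hW; have WV' : W \subset V1 :|: V2.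
      apply/fintype.subsetP => t /WV; rewrite !inE => /orP[/andP[_ ->]|->] //.
      by rewrite orbT.
    have /orP[W1|->] := sV W WV' hW; last by rewrite orbT.
    apply/orP; left; apply/fintype.subsetP => t tW.
    have := WV t tW; rewrite !inE => /orP[//|t2].
    by have := disjointFr dV (fintype.subsetP W1 t tW); rewrite t2.
have [U2|U2] := boolP (U \subset V2); last first.
  rewrite add0r; case: ifP => // /sV/(_ hU).
  by rewrite (negPf U1) (negPf U2).
rewrite add0r (fintype.subset_trans U2) ?finset.subsetUr //.
have -> : (V1 :|: V2) :\: U = V1 :|: (V2 :\: U).
  rewrite finset.setDUl; congr (_ :|: _); apply/finset.setDidPl.
  exact: disjointWr U2 dV.
rewrite IHn -?scalerAr //.
- by apply: leq_trans Vn; rewrite ltn_add2l card_setD_lt.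
- exact: disjointWr (finset.subsetDl _ _) dV.
- move=> W /fintype.subsetP WV hW; have WV' : W \subset V1 :|: V2.
    apply/fintype.subsetP => t /WV; rewrite !inE => /orP[->|/andP[_ ->]] //.
    by rewrite orbT.
  have /orP[->//|W2] := sV W WV' hW.
  apply/orP; right; apply/fintype.subsetP => t tW.
  have := WV t tW; rewrite !inE => /orP[t1|//].
  by have := disjointFl dV (fintype.subsetP W2 t tW); rewrite t1.
Qed.

Lemma hat_expU V1 V2 : [disjoint V1 & V2] ->
    (forall U, U \subset V1 :|: V2 -> hat S f U != 0 ->
      (U \subset V1) || (U \subset V2)) ->
  hat S (series_exp f) (V1 :|: V2) =
  hat S (series_exp f) V1 * hat S (series_exp f) V2.
Proof. by move=> dV sV; rewrite !hat_exp_horner hat_polyU // hornerM. Qed.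

Lemma hat_exp_set0 : hat S (series_exp f) finset.set0 = 1.
Proof.
rewrite (@hat_exp 1) ?cards0 // big_ord1 invr1 mul1r hat_one.
by rewrite eqxx.
Qed.

End HatExp.

(** * Closed sets of half-edges *)

Lemma cconnected_neq0 (Y : Type) (A : gclass Y) :
  cconnected A -> A != to_class gempty.
Proof.
case/andP=> cA _; apply/negP => /eqP A0.
have := giso_card (repr_to_class (@gempty Y)); rewrite -A0 => AE.
by move: cA; rewrite AE card_void.
Qed.

Lemma connected_series0 (Y : Type) (f : gclass Y -> rat) :
  connected_series f -> f (to_class gempty) = 0.
Proof.
move=> fc; apply/eqP; apply: contraT => /fc/cconnected_neq0.
by rewrite eqxx.
Qed.

Section Stable.
Variables (Y : Type) (T : finType) (S : hdata Y T).
Implicit Types (U V : {set T}).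

Definition stable V : bool :=
  [forall t in V, (hvrot S t \in V) && (hedge S t \in V)].

Lemma stableP V :
  reflect {in V, forall t, hvrot S t \in V /\ hedge S t \in V} (stable V).
Proof.
apply: (iffP forall_inP) => sV t /sV; first by move/andP.
by case=> -> ->.
Qed.

Lemma emb_stable H (G : utgraph Y H) U : (0 < #|emb S G U|)%N -> stable U.
Proof.
by move=> /card_gt0P[f fU]; apply/forall_inP => t; exact: emb_closed fU.
Qed.

Lemma hat_stable (f : gclass Y -> rat) U : hat S f U != 0 -> stable U.
Proof.
case: (hat_cases S U) => [[A /emb_stable//]|[_ ->]].
by rewrite eqxx.
Qed.

(** For the data of a graph, the stable sets are the unions of components and the irreducible ones
    are the single components. *)
Definition irreducible V : Prop :=
  [/\ stable V, V != finset.set0 &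
      forall U, stable U -> U \subset V -> U != finset.set0 -> U = V].

(** By stability, a step in the graph never leads from V1 to V2 or back, so a connected graph stays
    on one side. This provides the separation hypothesis of [hat_expU]. *)
Lemma connected_emb_sep (A : gclass Y) U V1 V2 : cconnected A ->
    (0 < nemb S A U)%N -> stable V1 -> stable V2 -> [disjoint V1 & V2] ->
  U \subset V1 :|: V2 -> (U \subset V1) || (U \subset V2).
Proof.
move=> /andP[/card_gt0P[h0 _] /forallP cA] /card_gt0P[x /embP[xi xU xv xe _]].
move=> s1 s2 dV /fintype.subsetP UV.
suff aux W1 W2 : stable W1 -> stable W2 -> [disjoint W1 & W2] ->
    (forall h, (x h \in W1) || (x h \in W2)) -> x h0 \in W1 -> U \subset W1.
  have xV h : (x h \in V1) || (x h \in V2).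
    by have := UV (x h); rewrite inE; apply; rewrite -xU imset_f.
  have /orP[x1|x2] := xV h0; first by rewrite (aux V1 V2).
  rewrite (aux V2 V1) ?orbT // 1?disjoint_sym // => h.
  by rewrite orbC.
move=> {s1 s2} /stableP s1 /stableP s2 {}dV xV x0.
apply/fintype.subsetP => t; rewrite -xU => /imsetP[h _ ->].
have := closed_connect _ (forallP (cA h0) h) => /(_ [pred k | x k \in W1]).
rewrite !inE => <- // {h t} h k /=.
have [xh|xh] := boolP (x h \in W1).
  have [w1 w2] := s1 _ xh.
  by move=> /orP[] /eqP<-; rewrite !inE ?xv ?xe xh ?w1 ?w2.
have {}xV : x h \in W2 by have := xV h; rewrite (negPf xh).
have [w1 w2] := s2 _ xV.
by move=> /orP[] /eqP<-; rewrite !inE ?xv ?xe (negPf xh) (disjointFl dV).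
Qed.

(** The image of what can be reached from one half-edge is stable and nonempty, hence all of V. *)
Lemma irreducible_connected (A : gclass Y) V :
  irreducible V -> (0 < nemb S A V)%N -> cconnected A.
Proof.
move=> [_ V0 irrV] /card_gt0P[x xemb].
have cA := emb_card xemb; move/embP: xemb => [xi xV xv xe _].
apply/andP; split; first by rewrite cA card_gt0.
apply/forallP => h; set e : rel _ := [rel a b | _].
pose C := [set k | connect e h k].
have CV : x @: C = V.
  apply: irrV; last 1 first.
  - by apply/set0Pn; exists (x h); rewrite imset_f // inE connect0.
  - apply/stableP => _ /imsetP[k + ->]; rewrite inE => hk.
    rewrite -xv -xe; split; apply: imset_f; rewrite inE;
      apply: connect_trans hk (connect1 _); by rewrite /e /= eqxx ?orbT.
  - by apply/fintype.subsetP => _ /imsetP[k _ ->]; rewrite -xV imset_f.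
apply/forallP => k; have : x k \in x @: C by rewrite CV -xV imset_f.
by move=> /imsetP[k' + /xi->]; rewrite inE.
Qed.

(** With two or more factors, the first one sits on a nonempty stable subset, hence on V itself, and
    leaves no half-edge for the others. Power 0 lives on the empty set, so only power 1 is left. *)
Lemma hat_irreducible_exp (f : gclass Y -> rat) V :
    f (to_class gempty) = 0 -> irreducible V ->
  hat S (series_exp f) V = hat S f V.
Proof.
move=> f0 [_ V0 irrV].
have powS j : hat S (series_pow f j.+1) V = hat S f V * (j == 0%N)%:R.
  rewrite [series_pow _ _]/= hat_mul (bigD1 V) //= finset.setDv big1 ?addr0.
    case: j => [|j]; first by rewrite hat_one eqxx.
    by rewrite hat_pow_eq0 ?cards0.
  move=> U /andP[UV UneV]; have [->|hU] := eqVneq (hat S f U) 0.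
    by rewrite mul0r.
  case/eqP: UneV; apply: irrV => //; first exact: hat_stable hU.
  exact: hat_neq0 hU.
have cV : (0 < #|V|)%N by rewrite card_gt0.
rewrite (hat_exp S f0 (ltnSn _)) -(prednK cV) !big_ord_recl hat_one (negPf V0).
rewrite mulr0 add0r powS big1 ?addr0 ?mulr1 => [|j _].
  by rewrite invr1 mul1r.
by rewrite powS mulr0 mulr0.
Qed.

End Stable.

Section StableGraph.
Variables (Y : Type) (T : finType) (G : utgraph Y T).
Implicit Types (U V : {set T}).

(** As [vrot] has cube the identity and [edge] is an involution, a stable set cannot be entered from
    outside. *)
Lemma stableD U V :
  stable (data_of G) U -> stable (data_of G) V -> stable (data_of G) (V :\: U).
Proof.
move=> /stableP sU /stableP sV; apply/stableP => t.
rewrite !inE => /andP[tU /sV[-> ->]]; rewrite !andbT; split.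
  apply: contra tU => tU; rewrite -(vrot3 G t).
  by have [/sU[]] := sU _ tU.
by apply: contra tU => /sU[_]; rewrite /= edgeK.
Qed.

(** A nonempty stable set that is not a single component splits into a proper stable subset and its
    complement, which is again stable. *)
Lemma stable_ind (P : {set T} -> Prop) :
    P finset.set0 ->
    (forall V, irreducible (data_of G) V -> P V) ->
    (forall U V, stable (data_of G) U -> stable (data_of G) V ->
       [disjoint U & V] -> P U -> P V -> P (U :|: V)) ->
  forall V, stable (data_of G) V -> P V.
Proof.
move=> P0 Pirr PU V; have [n] := ubnP #|V|; elim: n V => // n IHn V.
rewrite ltnS => Vn sV; have [->//|V0] := eqVneq V finset.set0.
have [irrV|nirr] := pselect (irreducible (data_of G) V); first exact: Pirr.
have [U [sU UV U0 UneV]] : exists U, [/\ stable (data_of G) U, U \subset V,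
    U != finset.set0 & U != V].
  apply: contrapT => nU; apply: nirr; split=> // U sU UV U0.
  by apply/eqP; apply: contraT => UneV; case: nU; exists U.
have VE : U :|: (V :\: U) = V.
  apply/setP => t; rewrite !inE; case: (boolP (t \in U)) => // tU.
  by rewrite (fintype.subsetP UV).
rewrite -VE; apply: PU => //.
- exact: stableD.
- rewrite finset.disjoints_subset; apply/fintype.subsetP => t.
  by rewrite !inE => ->.
- apply: IHn => //; apply: leq_trans Vn; apply: proper_card.
  by rewrite finset.properEneq UneV.
- by apply: IHn; [apply: leq_trans Vn; exact: card_setD_lt | exact: stableD].
Qed.

End StableGraph.

(** * Cutting and gluing *)

(** Double counting: each x of Q lies in exactly one E i. Gluings and cuts are both counted this
    way. *)
Lemma sum_card_unique (I J : finType) (P : pred I) (E : I -> {set J})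
    (Q : {set J}) :
    (forall i, P i -> E i \subset Q) ->
    (forall x, x \in Q -> exists2 i, P i & x \in E i) ->
    (forall i j x, P i -> P j -> x \in E i -> x \in E j -> i = j) ->
  (\sum_(i | P i) #|E i|)%N = #|Q|.
Proof.
move=> EQ QE Einj.
transitivity (\sum_(i | P i) \sum_(x in Q) (x \in E i))%N.
  apply: eq_bigr => i /EQ/fintype.subsetP EQi.
  rewrite -sum1_card big_mkcond [RHS]big_mkcond /=; apply: eq_bigr => x _.
  by case: (boolP (x \in E i)) => [/EQi->|_]; rewrite ?if_same.
rewrite exchange_big -sum1_card; apply: eq_bigr => x xQ.
have [i Pi xi] := QE x xQ; rewrite (bigD1 i) //= xi big1 // => j /andP[Pj ji].
case: (boolP (x \in E j)) => // xj.
by rewrite (Einj _ _ _ Pj Pi xj xi) eqxx in ji.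
Qed.

Section Cut.
Variables (Y : Type) (X : finType) (col : X -> Y).
Variables (T : finType) (K : utgraph void T).
Implicit Types (s : {ffun T -> option X}) (V : {set T}).

(* The half-edge (k, false) is k itself; if the edge of k is cut, which is what
   [s k = Some x] means, then (k, true) is a new x-coloured univalent vertex at
   the end of the remaining part of that edge. *)
Definition cut s : hdata Y (T * bool) := HData
  (fun p => if p.2 then p else (vrot K p.1, false))
  (fun p => if p.2 then (p.1, false) else
            if s p.1 then (p.1, true) else (edge K p.1, false))
  (fun p => if p.2 then omap col (s p.1) else None).

Definition cut_set s V : {set T * bool} :=
  [set p | (p.1 \in V) && (p.2 ==> s p.1)].

(** Both halves of an edge receive the same value, so the two new ends of a cut edge have equal
    colours and can be glued back. Labels in the finite type X make the sum over cuts finite. *)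
Definition cut_of V s : bool :=
  [forall k, (s (edge K k) == s k) && (s k ==> (k \in V))].

Lemma cut_ofP V s :
  reflect (forall k, s (edge K k) = s k /\ (s k -> k \in V)) (cut_of V s).
Proof.
apply: (iffP forallP) => sP k.
  by have /andP[/eqP sE /implyP sV] := sP k.
by have [-> sV] := sP k; rewrite eqxx; apply/implyP.
Qed.

Lemma vrot_neq k : vrot K k != k.
Proof. by rewrite -(colourE K); case: (colour K k) => [[]|]. Qed.

Section CutGlue.
Hypothesis col_inj : injective col.
Variables (H : finType) (A : utgraph Y H) (ns : strut_free A) (V : {set T}).
Hypothesis col_A : forall h y, colour A h = Some y -> exists x, col x = y.
Local Notation leg := (leg A).
Local Notation inner := (inner A).

Lemma edge_leg h : univalent A h -> ~~ univalent A (edge A h).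
Proof. by have /forallP/(_ h)/implyP := ns. Qed.

(** The inner half-edge nearest to h: without struts, the edge of a leg ends at a trivalent vertex.
    It serves to extend maps on [inner] to all of H. *)
Definition inward_half (h : H) : H := if univalent A h then edge A h else h.

Lemma inward_subproof h : ~~ univalent A (inward_half h).
Proof. by rewrite /inward_half; case: ifP => [/edge_leg|->]. Qed.

Definition inward h : inner :=
  exist (fun x => ~~ univalent A x) _ (inward_subproof h).

Lemma val_inward_leg h : univalent A h -> val (inward h) = edge A h.
Proof. by rewrite /= /inward_half => ->. Qed.

Lemma inwardK (i : inner) : inward (val i) = i.
Proof. by apply: val_inj; rewrite /= /inward_half (negPf (valP i)). Qed.

Lemma val_inward h : ~~ univalent A h -> val (inward h) = h.
Proof. by rewrite /= /inward_half => /negPf->. Qed.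

Lemma inward_leg_inj (l l' : leg) : inward (val l) = inward (val l') -> l = l'.
Proof.
move=> /(congr1 val); rewrite !val_inward_leg ?(valP l) ?(valP l') //.
by move/(can_inj (edgeK A))/val_inj.
Qed.

Lemma glue_edge_inner (m : pairing A) (i : inner) :
  ~~ univalent A (edge A (val i)) ->
  glue_edge ns m i = inward (edge A (val i)).
Proof.
move=> ui; apply: val_inj; rewrite val_inward //= /glue_other.
by case: insubP => // l ul; rewrite ul in ui.
Qed.

Lemma glue_edge_leg (m : pairing A) (l : leg) :
  glue_edge ns m (inward (val l)) = inward (val (val m l)).
Proof.
have ul := valP l; have um := valP (val m l).
apply: val_inj; rewrite (val_inward_leg um) [LHS]/= /glue_other.
rewrite /inward_half ul edgeK; case: insubP => [l' _ /val_inj->//|].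
by rewrite ul.
Qed.

(* The embeddings of A glued along some pairing, and also the restrictions to
   the inner half-edges of the embeddings of A into K cut in some way. *)
Definition glued_spec (f : {ffun inner -> T}) : Prop :=
  [/\ injective f, f @: [set: inner] = V,
      forall i, f (inward (vrot A (val i))) = vrot K (f i),
      forall i, ~~ univalent A (edge A (val i)) ->
        f (inward (edge A (val i))) = edge K (f i) &
      forall l : leg, exists2 l' : leg, colour A (val l') = colour A (val l) &
        f (inward (val l')) = edge K (f (inward (val l)))].

Definition glued : {set {ffun inner -> T}} := [set f | `[< glued_spec f >]].

Lemma gluedP f : reflect (glued_spec f) (f \in glued).
Proof. by rewrite inE; exact: asboolP. Qed.

Lemma glue_vrotE (i : inner) : glue_vrot i = inward (vrot A (val i)).
Proof. by apply: val_inj; rewrite val_inward //; exact: glue_vrot_inner. Qed.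

(** The pairing is recovered from f: [edge K] links the images of the inner neighbours of paired
    legs, and these neighbours determine the legs. *)
Lemma sum_card_emb_glue :
  (\sum_(m : pairing A) #|emb (data_of K) (Defs.glue ns m) V|)%N = #|glued|.
Proof.
apply: sum_card_unique => [m _|f /gluedP[fi fV fv fe fl]|m m' f _ _].
- apply/fintype.subsetP => f /embP[fi fV fv fe _]; apply/gluedP; split=> //.
  + by move=> i; rewrite -glue_vrotE; exact: fv.
  + by move=> i ui; rewrite -(glue_edge_inner m) //; exact: fe.
  + move=> l; exists (val m l).
      by have /forallP/(_ l)/and3P[_ _ /asboolP] := valP m.
    by rewrite -(glue_edge_leg m); exact: fe.
(* The partner map [g] is an involution without fixed points because [edge K] is one. *)
- have /choice[g gP] (l : leg) : exists l' : leg,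
      colour A (val l') = colour A (val l) /\
      f (inward (val l')) = edge K (f (inward (val l))).
    by have [l'] := fl l; exists l'.
  have mP : is_pairing [ffun l => g l].
    apply/forallP => l; rewrite !ffunE; have [gc ge] := gP l.
    apply/and3P; split; last exact/asboolP.
      apply/eqP/inward_leg_inj/fi; have [_ ->] := gP (g l).
      by rewrite ge edgeK.
    apply/eqP => gl; have := edge_neq K (f (inward (val l))).
    by rewrite -ge gl eqxx.
  exists (exist (fun m => is_pairing m) _ mP) => //.
  apply/embP; split=> //.
  + by move=> i; rewrite [vrot _ _]glue_vrotE fv.
  + move=> i /=; have [u|u] := boolP (univalent A (edge A (val i))).
      pose l : leg := exist (fun h => univalent A h) _ u.
      have -> : i = inward (val l).
        by apply: val_inj; rewrite val_inward_leg //= edgeK.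
      by rewrite glue_edge_leg /= ffunE; case: (gP l).
    by rewrite glue_edge_inner // fe.
  + by move=> i /=; case: (colour K _) => [[]|].
- move=> /embP[fi _ _ fe _] /embP[_ _ _ fe' _].
  apply/val_inj/ffunP => l; apply/inward_leg_inj/fi.
  by rewrite -!(glue_edge_leg _ l) fe fe'.
Qed.

(** A leg goes to the new end attached to the image of its inner neighbour. *)
Definition cut_map (f : {ffun inner -> T}) : {ffun H -> T * bool} :=
  [ffun h => (f (inward h), univalent A h)].

Lemma cut_map_inj : injective cut_map.
Proof.
move=> f f' /ffunP ff'; apply/ffunP => i.
by have := ff' (val i); rewrite !ffunE inwardK => -[].
Qed.

Lemma emb_cut_glued s g : cut_of V s -> g \in emb (cut s) A (cut_set s V) ->
  exists2 f, f \in glued & g = cut_map f.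
Proof.
move=> /cut_ofP sV /embP[gi gV gv ge gc].
(* K has no univalent vertices, so the rotation of the cut graph fixes exactly the new ends. *)
have gu h : (g h).2 = univalent A h.
  have := gv h; rewrite /univalent /=; case: ifP => [_ /gi->|nb].
    by rewrite eqxx.
  move=> gvE; apply/esym/eqP => vh; move: gvE; rewrite vh => /(congr1 fst)/=.
  by move/esym/eqP; rewrite (negPf (vrot_neq _)).
pose f : {ffun inner -> T} := [ffun i => (g (val i)).1].
have gE (i : inner) : g (val i) = (f i, false).
  by rewrite ffunE [g _]surjective_pairing gu (negPf (valP i)).
have gl (l : leg) : g (val l) = (f (inward (val l)), true).
  have := ge (val l); rewrite -(val_inward_leg (valP l)) gE /= gu (valP l).
  move=> [->]; rewrite [LHS]surjective_pairing gu.
  by rewrite (valP l).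
have sV' h : (g h \in cut_set s V) by rewrite -gV imset_f.
exists f.
  apply/gluedP; split.
  - by move=> i j ij; apply/val_inj/gi; rewrite !gE ij.
  - apply/setP => t; apply/imsetP/idP => [[i _ ->]|tV].
      by have := sV' (val i); rewrite gE inE => /andP[].
    have : (t, false) \in cut_set s V by rewrite inE tV.
    rewrite -gV => /imsetP[h _ gh].
    have nu : ~~ univalent A h by rewrite -gu -gh.
    exists (inward h) => //; have := gE (inward h).
    by rewrite (val_inward nu) => /(etrans gh)[].
  - move=> i; have := gv (val i); rewrite gE /=.
    rewrite -glue_vrotE -[vrot A (val i)]/(val (glue_vrot i)) gE.
    by case.
  - move=> i ui; have := ge (val i); rewrite -{1}(val_inward ui) !gE /=.
    by case: (s _) => [x|] /= [].
  (* The partner of l is the leg sent to the new end on the other half of the same cut edge, where s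
     has the same value. *)
  - move=> l; have := sV' (val l); rewrite gl inE /= => /andP[_ sl].
    have [sE _] := sV (f (inward (val l))).
    have : (edge K (f (inward (val l))), true) \in cut_set s V.
      rewrite inE /= sE sl andbT; have [_] := sV (edge K (f (inward (val l)))).
      by apply; rewrite sE.
    rewrite -gV => /imsetP[h _ gh].
    have uh : univalent A h by rewrite -gu -gh.
    pose l' : leg := exist (fun h => univalent A h) _ uh.
    have := gl l'; rewrite [val l']/= -gh => -[ee].
    exists l'; last by rewrite -ee.
    by rewrite -!gc !gl /= -ee sE.
apply/ffunP => h; rewrite ffunE; have [u|u] := boolP (univalent A h).
  exact: (gl (exist (fun h => univalent A h) _ u)).
by rewrite -{1}(val_inward u) gE.
Qed.

(** The edges to cut are those through the images of inner neighbours of legs, labelled by the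
    colours of the legs. *)
Lemma glued_emb_cut f : f \in glued ->
  exists2 s, cut_of V s & cut_map f \in emb (cut s) A (cut_set s V).
Proof.
move=> /gluedP[fi fV fv fe fl].
have /choice[xc xcE] (l : leg) : exists x, Some (col x) = colour A (val l).
  have := valP l; rewrite /univalent -colourE.
  by case E: (colour A (val l)) => [y|//] _; have [x <-] := col_A E; exists x.
pose s := [ffun k => omap xc [pick l : leg | f (inward (val l)) == k]].
have sl (l : leg) : s (f (inward (val l))) = Some (xc l).
  rewrite ffunE; case: pickP => [l' /eqP/fi/inward_leg_inj->//|/(_ l)].
  by rewrite eqxx.
have s_leg k : s k -> exists l : leg, k = f (inward (val l)).
  by rewrite ffunE; case: pickP => // l /eqP<- _; exists l.
have sN k : s k = None \/ exists l : leg, k = f (inward (val l)).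
  by case E: (s k) => [x|]; [right; apply: s_leg; rewrite E | left].
exists s.
  apply/cut_ofP => k; split; last first.
    by move=> /s_leg[l ->]; rewrite -fV imset_f.
  have [sk|[l ->]] := sN k; last first.
    have [l' lc <-] := fl l; rewrite !sl; congr Some; apply: col_inj.
    by have := xcE l; rewrite -lc -xcE => -[].
  have [->//|[l kE]] := sN (edge K k).
  have [l' _] := fl l; rewrite -kE edgeK => kE'.
  by move: sk; rewrite -kE' sl.
have uE h : ~~ univalent A h -> colour A h = None.
  by rewrite /univalent -colourE; case: (colour A h).
apply/embP; split.
- move=> h k; rewrite !ffunE => -[/fi/(congr1 val)]; rewrite /= /inward_half.
  move=> + uu; rewrite -uu; case: ifP => // _.
  exact: (can_inj (edgeK A)).
- apply/setP => -[t b]; rewrite inE /=; apply/imsetP/andP.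
    case=> h _; rewrite ffunE => -[-> ->]; split; first by rewrite -fV imset_f.
    apply/implyP => u.
    by rewrite (sl (exist (fun h => univalent A h) _ u)).
  case: b => /= -[tV st].
    have [l tE] := s_leg _ st; exists (val l) => //.
    by rewrite ffunE (valP l) tE.
  move: tV; rewrite -fV => /imsetP[i _ ->]; exists (val i) => //.
  by rewrite ffunE inwardK (negPf (valP i)).
- move=> h; rewrite !ffunE /=; have [u|u] := boolP (univalent A h).
    by rewrite (eqP u) u.
  have -> : univalent A (vrot A h) = false.
    apply: negbTE; rewrite -(val_inward u); exact: glue_vrot_inner.
  by rewrite -fv val_inward.
- move=> h; rewrite !ffunE /=; have [u|u] := boolP (univalent A h).
    rewrite (negPf (edge_leg u)); congr (f _, _); apply: val_inj.
    by rewrite (val_inward_leg u) (val_inward (edge_leg u)).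
  have [ue|ue] := boolP (univalent A (edge A h)).
    have -> : inward h = inward (edge A h).
      by apply: val_inj; rewrite (val_inward_leg ue) (val_inward u) edgeK.
    by rewrite (sl (exist (fun h => univalent A h) _ ue)).
  have [->|[l hl]] := sN (f (inward h)); last first.
    move/fi/(congr1 val): hl; rewrite val_inward // val_inward_leg ?(valP l) //.
    by move=> hE; rewrite hE edgeK (valP l) in ue.
  by rewrite -fe val_inward.
- move=> h; rewrite !ffunE /=; case: ifP => [u|/negbT/uE->//].
  by rewrite (sl (exist (fun h => univalent A h) _ u)) /= xcE.
Qed.

(** The image of g shows which half-edges of V are cut, and the colours of A give the labels;
    outside V both cuts are [None]. *)
Lemma emb_cut_unique s s' g : cut_of V s -> cut_of V s' ->
    g \in emb (cut s) A (cut_set s V) -> g \in emb (cut s') A (cut_set s' V) ->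
  s = s'.
Proof.
move=> /cut_ofP sV /cut_ofP s'V /embP[_ gV _ _ gc] /embP[_ gV' _ _ gc'].
have ss' : cut_set s V = cut_set s' V by rewrite -gV -gV'.
apply/ffunP => k; have [kV|kV] := boolP (k \in V); last first.
  case: (sV k) (s'V k) => _ + [_].
  by case: (s k) (s' k) => [x|] [y|] // => [/(_ isT)|/(_ isT)|_ /(_ isT)] kV';
    rewrite kV' in kV.
have : ((k, true) \in cut_set s V) = ((k, true) \in cut_set s' V).
  by rewrite ss'.
case E: (s k) => [x|]; last by rewrite !inE /= E kV; case: (s' k).
rewrite {1}inE /= kV E => /esym.
case E': (s' k) => [x'|]; last by rewrite inE E' andbF.
rewrite -gV' => /imsetP[h _ gh].
by have := gc h; rewrite -gc' -gh /= E E' /= => -[/col_inj->].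
Qed.

Lemma sum_card_emb_cut :
  (\sum_(s | cut_of V s) #|emb (cut s) A (cut_set s V)|)%N = #|glued|.
Proof.
rewrite -(card_imset _ cut_map_inj); apply: sum_card_unique => [s sV|g|].
- apply/fintype.subsetP => g /(emb_cut_glued sV)[f fg ->].
  exact: imset_f.
- by move=> /imsetP[f /glued_emb_cut[s sV fs] ->]; exists s.
- exact: emb_cut_unique.
Qed.

End CutGlue.

End Cut.

(** * Finiteness and the bracket *)

Lemma series_mul_neq0 (Y : Type) (f g : gclass Y -> rat) A :
  series_mul f g A != 0 ->
  exists B D, [/\ cunion B D = A, f B != 0 & g D != 0].
Proof.
move=> fgA; apply: contrapT => n; case/eqP: fgA; apply: fsbig1 => -[B D] /= BD.
have [->|fB] := eqVneq (f B) 0; first by rewrite mul0r.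
have [->|gD] := eqVneq (g D) 0; first by rewrite mulr0.
by case: n; exists B, D.
Qed.

Lemma series_exp_neq0 (Y : Type) (f : gclass Y -> rat) A :
  series_exp f A != 0 -> exists j, series_pow f j A != 0.
Proof.
move=> fA; apply: contrapT => n; case/eqP: fA; apply: fsbig1 => j _.
have [->|fj] := eqVneq (series_pow f j A) 0; first by rewrite mulr0.
by case: n; exists j.
Qed.

Section StrutFree.
Variable Y : Type.

Lemma strut_free_giso (H1 H2 : finType) (G1 : utgraph Y H1)
    (G2 : utgraph Y H2) : giso G1 G2 -> strut_free G1 -> strut_free G2.
Proof.
move=> [f [[g fK gK] fv fe fc]] /forallP s1; apply/forallP => h.
have uE k : univalent G2 (f k) = univalent G1 k.
  by rewrite /univalent -fv (inj_eq (can_inj fK)).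
by rewrite -(gK h) -fe !uE.
Qed.

Lemma strut_free_gunion (H1 H2 : finType) (G1 : utgraph Y H1)
    (G2 : utgraph Y H2) :
  strut_free G1 -> strut_free G2 -> strut_free (gunion G1 G2).
Proof.
by move=> /forallP s1 /forallP s2; apply/forallP => -[h|h];
  [exact: s1 | exact: s2].
Qed.

Lemma substantial_mul (f g : gclass Y -> rat) :
  substantial f -> substantial g -> substantial (series_mul f g).
Proof.
move=> sf sg A /series_mul_neq0[B [D [<- /sf sB /sg sD]]].
apply: strut_free_giso (giso_sym (repr_to_class _)) _.
exact: strut_free_gunion.
Qed.

Lemma substantial_one : substantial (@series_one Y).
Proof.
move=> A; rewrite /series_one; have [-> _|_] := eqVneq A (to_class gempty);
  last by rewrite eqxx.
apply: strut_free_giso (giso_sym (repr_to_class _)) _.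
by apply/forallP => -[].
Qed.

Lemma substantial_exp (f : gclass Y -> rat) :
  substantial f -> substantial (series_exp f).
Proof.
move=> sf A /series_exp_neq0[j]; elim: j A => [|j IHj] A.
  exact: substantial_one.
exact: substantial_mul.
Qed.

End StrutFree.

Section LocallyFinite.
Variable Y : Type.
Implicit Types f g : gclass Y -> rat.

(** Half-edges replace vertices as the grading: their number is additive under disjoint union, and
    gluing a strut-free graph at most halves it. *)
Definition size_support n f : set (gclass Y) :=
  [set A | (nhalf (grepr A) <= n)%N /\ f A != 0]%classic.

Definition locally_finite f : Prop := forall n, finite_set (size_support n f).

Lemma series_locally_finite f : is_series f -> locally_finite f.
Proof.
move=> fs n; pose F k := [set A | nverts (grepr A) = k /\ f A != 0]%classic.
apply: (@sub_finite_set _ _ (\bigcup_(k in `I_n.+1) F k)%classic).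
  move=> A [An fA]; exists (nverts (grepr A)) => //=; rewrite ltnS.
  apply: leq_trans An; rewrite /nverts /n_comp_mem.
  by apply: leq_trans (max_card _) _; rewrite card_ord.
by apply: bigcup_finite => // k _; exact: fs.
Qed.

Lemma nhalf_to_class (H : finType) (G : utgraph Y H) :
  nhalf (grepr (to_class G)) = #|H|.
Proof. by rewrite -(giso_card (repr_to_class G)) card_ord. Qed.

Lemma nhalf_cunion (A B : gclass Y) :
  nhalf (grepr (cunion A B)) = (nhalf (grepr A) + nhalf (grepr B))%N.
Proof. by rewrite nhalf_to_class card_sum !card_ord. Qed.

Lemma locally_finite_mul f g :
  locally_finite f -> locally_finite g -> locally_finite (series_mul f g).
Proof.
move=> lf lg n; apply: (@sub_finite_set _ _ ((fun p => cunion p.1 p.2) @`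
  (size_support n f `*` size_support n g))%classic).
  move=> A [An /series_mul_neq0[B [D [BD fB gD]]]]; exists (B, D) => //.
  move: An; rewrite -BD nhalf_cunion => An.
  by split; split=> //=; apply: leq_trans An; rewrite ?leq_addr ?leq_addl.
exact/finite_image/finite_setX.
Qed.

Lemma locally_finite_pow f j :
  locally_finite f -> locally_finite (series_pow f j).
Proof.
move=> lf; elim: j => [|j IHj]; last exact: locally_finite_mul.
move=> n; apply: (@sub_finite_set _ _ [set to_class gempty]%classic).
  move=> A [_]; rewrite /= /series_one.
  by have [->|_] := eqVneq A (to_class gempty); last rewrite eqxx.
exact: finite_set1.
Qed.

Lemma hat_repr f (A : gclass Y) : hat (data_of (grepr A)) f [set: _] =
  f A * (nemb (data_of (grepr A)) A [set: _])%:R.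
Proof. by apply: hat_class; exact: emb_refl. Qed.

Lemma series_pow_eq0 f j A : f (to_class gempty) = 0 ->
  (nhalf (grepr A) < j)%N -> series_pow f j A = 0.
Proof.
move=> f0 Aj; have NA := emb_refl (grepr A).
have := @hat_pow_eq0 _ _ (data_of (grepr A)) _ f0 j [set: _].
rewrite cardsT card_ord => /(_ Aj)/eqP; rewrite hat_repr mulf_eq0.
by rewrite pnatr_eq0 (gtn_eqF NA) orbF => /eqP.
Qed.

Lemma series_expE f n A : f (to_class gempty) = 0 ->
  (nhalf (grepr A) < n)%N ->
  series_exp f A = \sum_(j < n) j`!%:R^-1 * series_pow f j A.
Proof.
move=> f0 An; rewrite (fsbig_ord _ n (fun j => j`!%:R^-1 * series_pow f j A)).
apply/esym/fsbig_widen => // j [_ /negP]; rewrite -leqNgt => nj /=.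
by rewrite series_pow_eq0 ?mulr0 // (leq_trans An).
Qed.

Lemma locally_finite_exp f : f (to_class gempty) = 0 ->
  locally_finite f -> locally_finite (series_exp f).
Proof.
move=> f0 lf n; apply: (@sub_finite_set _ _
    (\bigcup_(j in `I_n.+1) size_support n (series_pow f j))%classic).
  move=> A [An /series_exp_neq0[j fj]]; exists j => //=; rewrite ltnS.
  apply: leq_trans An; rewrite leqNgt; apply: contra fj => Aj.
  by rewrite series_pow_eq0.
by apply: bigcup_finite => // j _; exact: locally_finite_pow.
Qed.

(** Finitely many graphs have finitely many half-edges. This provides the finite label type of [cut]
    although Y is arbitrary. *)
Lemma finite_colours (D : set (gclass Y)) : finite_set D ->
  exists (X : finType) (col : X -> Y), injective col /\
    forall A, D A -> forall h y, colour (grepr A) h = Some y ->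
      exists x, col x = y.
Proof.
move=> /finite_seqP[r rD]; pose cols (A : gclass Y) : seq {classic Y} :=
  pmap (colour (grepr A) : _ -> option {classic Y}) (enum 'I_(nhalf (grepr A))).
pose l := flatten [seq cols A | A <- r].
exists (seq_sub l), (fun x => ssval x); split; first exact: val_inj.
move=> A DA h y hy; have yl : (y : {classic Y}) \in l.
  apply/flatten_mapP; exists A; first by move: DA; rewrite rD.
  by rewrite mem_pmap; apply/mapP; exists h; rewrite ?mem_enum.
by exists (SeqSub yl).
Qed.

End LocallyFinite.

(** [bracket_graph] matches on a proof of strut-freeness; any other proof gives the same value by
    proof irrelevance. *)
Lemma reflect_matchT (P : Prop) b (r : reflect P b) (Z : Type) (g : P -> Z)
    (z : Z) (p : P) :
  match r with ReflectT q => g q | ReflectF _ => z end = g p.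
Proof. by case: r => // q; rewrite (Prop_irrelevance q p). Qed.

Lemma reflect_matchF (P : Prop) b (r : reflect P b) (Z : Type) (g : P -> Z)
    (z : Z) : ~ P ->
  match r with ReflectT q => g q | ReflectF _ => z end = z.
Proof. by case: r. Qed.

Section Bracket.
Variable Y : Type.
Implicit Types (f : gclass Y -> rat) (A : gclass Y).

Lemma bracket_graphE A (ns : strut_free (grepr A)) B :
  bracket_graph A B =
  \sum_(m : pairing (grepr A)) (to_class (Defs.glue ns m) == B)%:R.
Proof.
by rewrite /bracket_graph (reflect_matchT (@idP (cstrut_free A)) _ _ ns).
Qed.

Lemma bracket_graph_strut A B :
  ~~ strut_free (grepr A) -> bracket_graph A B = 0.
Proof.
move=> /negP ns.
by rewrite /bracket_graph (reflect_matchF (@idP (cstrut_free A)) _ _ ns).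
Qed.

(** [inward] is injective on legs, so at most half of the half-edges are legs. *)
Lemma card_strut_free (H : finType) (G : utgraph Y H) :
  strut_free G -> (#|H| <= #|{: inner G}| + #|{: inner G}|)%N.
Proof.
move=> ns; rewrite -(cardC (univalent G)) -[X in (_ + X)%N]card_sig.
rewrite -[X in (X + _)%N]card_sig leq_add2r.
exact: leq_card (@inward_leg_inj _ _ _ ns).
Qed.

Lemma bracket_graph_neq0 A B : bracket_graph A B != 0 ->
  cstrut_free A /\ exists (H : finType) (G : utgraph void H),
    [/\ to_class G = B, (#|H| <= nhalf (grepr A))%N &
        (nhalf (grepr A) <= #|H| + #|H|)%N].
Proof.
have [ns|ns] := boolP (strut_free (grepr A)); last first.
  by rewrite bracket_graph_strut ?eqxx.
rewrite (bracket_graphE ns) => n0; split=> //.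
have [m /eqP mB] : exists m, to_class (Defs.glue ns m) == B.
  apply/existsP; apply: contraNT n0; rewrite negb_exists => /forallP n.
  by rewrite big1 // => m _; rewrite (negPf (n m)).
exists (inner (grepr A)), (Defs.glue ns m); split=> //.
  by rewrite card_sig -[leqRHS]card_ord max_card.
by rewrite -[leqLHS]card_ord card_strut_free.
Qed.

Lemma nhalf_bracket_graph A B : bracket_graph A B != 0 ->
  (nhalf (grepr B) <= nhalf (grepr A) <= (nhalf (grepr B)).*2)%N.
Proof.
move=> /bracket_graph_neq0[_ [H [G [<- H1 H2]]]].
by rewrite nhalf_to_class H1 -addnn.
Qed.

Lemma bracketE f (D : set (gclass Y)) B :
  (size_support (nhalf (grepr B)).*2 f `<=` D)%classic ->
  bracket f B = \sum_(A \in D) f A * bracket_graph A B.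
Proof.
move=> fD; apply/esym/fsbig_widen => // A [_ nA] /=.
have [->|fA] := eqVneq (f A) 0; first by rewrite mul0r.
have [->|bA] := eqVneq (bracket_graph A B) 0; first by rewrite mulr0.
by case: nA; apply: fD; split=> //; have /andP[] := nhalf_bracket_graph bA.
Qed.

Section HatBracket.
Variables (T : finType) (K : utgraph void T).
Implicit Types U V : {set T}.

Lemma hat_bracket_graph A (ns : strut_free (grepr A)) V :
  hat (data_of K) (bracket_graph A) V =
  (\sum_(m : pairing (grepr A)) #|emb (data_of K) (Defs.glue ns m) V|)%:R.
Proof.
rewrite natr_sum; case: (hat_cases (data_of K) V) => [[B NB ->]|[N0 ->]].
  rewrite (bracket_graphE ns) mulr_suml; apply: eq_bigr => m _.
  rewrite -card_emb_class; case: eqP => [->|mB]; first by rewrite mul1r.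
  have [->|Nm] := posnP (nemb (data_of K) (to_class (Defs.glue ns m)) V).
    by rewrite mul0r.
  by case: mB; exact: emb_class Nm NB.
by rewrite big1 // => m _; rewrite -card_emb_class N0.
Qed.

Variables (X : finType) (col : X -> Y) (f : gclass Y -> rat).
Hypotheses (col_inj : injective col)
  (col_f : forall A, size_support (#|T|).*2 f A -> forall h y,
     colour (grepr A) h = Some y -> exists x, col x = y)
  (f_fin : locally_finite f) (f_sub : substantial f).

(** For each A, the sum over pairings and the sum over cuts both count [glued]; the rest is an
    exchange of sums. *)
Lemma hat_bracket V : hat (data_of K) (bracket f) V =
  \sum_(s | cut_of K V s) hat (cut col K s) f (cut_set s V).
Proof.
(* The doubled bound serves both sides: gluing at most halves the number of half-edges, and the cut
   graphs live on [T * bool]. *)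
pose D := size_support (#|T|).*2 f; have Dfin : finite_set D by exact: f_fin.
transitivity (\sum_(A \in D) f A * hat (data_of K) (bracket_graph A) V).
  case: (hat_cases (data_of K) V) => [[B NB hE]|[_ h0]]; last first.
    by rewrite h0 fsbig1 // => A _; rewrite h0 mulr0.
  have BT : (nhalf (grepr B) <= #|T|)%N.
    case/card_gt0P: NB => x /emb_card; rewrite card_ord => ->.
    exact: max_card.
  rewrite hE (bracketE (D := D)).
    by rewrite mulr_fsuml; apply: eq_fsbigr => A _; rewrite hE mulrA.
  by move=> A [AB fA]; split=> //; apply: leq_trans AB _; rewrite leq_double.
transitivity (\sum_(A \in D) \sum_(s | cut_of K V s)
    f A * (nemb (cut col K s) A (cut_set s V))%:R).
  apply: eq_fsbigr => A; rewrite inE => DA; have [_ fA] := DA.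
  have ns : strut_free (grepr A) by exact: f_sub fA.
  rewrite (hat_bracket_graph ns) -mulr_sumr -natr_sum.
  rewrite (sum_card_emb_glue K) -(sum_card_emb_cut K col_inj ns) //.
  exact: col_f.
rewrite fsbig_finite // exchange_big; apply: eq_bigr => s _ /=.
rewrite -fsbig_finite //; apply: fsbig_widen => // A [_ nA] /=.
have [->|fA] := eqVneq (f A) 0; first by rewrite mul0r.
have [->|/card_gt0P[x /emb_card]] := posnP (nemb (cut col K s) A (cut_set s V)).
  by rewrite mulr0.
rewrite card_ord => AE; case: nA; split=> //; rewrite AE -muln2 -card_bool.
by rewrite -card_prod max_card.
Qed.

End HatBracket.

End Bracket.

(** * Multiplicativity of the bracket of an exponential *)

Lemma hat_local (Y : Type) (T : finType) (S S' : hdata Y T)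
    (f : gclass Y -> rat) (U : {set T}) :
    {in U, forall t, [/\ hvrot S t = hvrot S' t, hedge S t = hedge S' t &
                         hcolour S t = hcolour S' t]} ->
  hat S f U = hat S' f U.
Proof.
move=> SS'; apply: eq_fsbigr => A _; congr (_ * _%:R); apply: eq_card => x.
by apply/embP/embP => -[xi xU xv xe xc]; split=> // h;
  have [] := SS' (x h) _; rewrite -?xU ?imset_f // => v e c;
  rewrite ?xv ?xe -?xc.
Qed.

Lemma hat_exp_sepU (Y : Type) (T : finType) (S : hdata Y T)
    (f : gclass Y -> rat) (V1 V2 : {set T}) : connected_series f ->
    stable S V1 -> stable S V2 -> [disjoint V1 & V2] ->
  hat S (series_exp f) (V1 :|: V2) =
  hat S (series_exp f) V1 * hat S (series_exp f) V2.
Proof.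
move=> fc s1 s2 dV; apply: hat_expU => //; first exact: connected_series0.
move=> U UV; case: (hat_cases S U) => [[A NA ->]|[_ ->]]; last by rewrite eqxx.
rewrite mulf_eq0 negb_or => /andP[/fc cA _].
exact: connected_emb_sep cA NA s1 s2 dV UV.
Qed.

Section CutUnion.
Variables (Y : Type) (X : finType) (col : X -> Y).
Variables (T : finType) (K : utgraph void T).
Implicit Types (s : {ffun T -> option X}) (U V : {set T}).

Definition restrict_cut V s : {ffun T -> option X} :=
  [ffun k => if k \in V then s k else None].

Lemma cut_set_restrict V s : cut_set (restrict_cut V s) V = cut_set s V.
Proof. by apply/setP => -[t b]; rewrite !inE /= ffunE; case: (t \in V). Qed.

Lemma hat_cut_restrict (f : gclass Y -> rat) V s :
  hat (cut col K s) f (cut_set s V) =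
  hat (cut col K (restrict_cut V s)) f (cut_set (restrict_cut V s) V).
Proof.
rewrite cut_set_restrict; apply: hat_local => -[t b]; rewrite inE /=.
by move=> /andP[tV _]; rewrite ffunE tV.
Qed.

Lemma stable_cut_set U V s : cut_of K U s -> stable (data_of K) V ->
  stable (cut col K s) (cut_set s V).
Proof.
move=> /cut_ofP sU /stableP sV; apply/stableP => -[t b]; rewrite inE /=.
move=> /andP[tV]; have [vV eV] := sV t tV.
case: b => /= st; first by rewrite !inE /= tV st.
split; first by rewrite inE /= vV.
by case E: (s t) => [x|]; rewrite inE /= ?tV ?E // eV.
Qed.

Lemma cut_setU U V s : cut_set s (U :|: V) = cut_set s U :|: cut_set s V.
Proof. by apply/setP => p; rewrite !inE andb_orl. Qed.

Lemma stable_edge V t : stable (data_of K) V -> (edge K t \in V) = (t \in V).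
Proof.
move=> /stableP sV; apply/idP/idP => [/sV[_]|/sV[]//].
by rewrite /= edgeK.
Qed.

(** A stable set contains both halves of each edge it meets, so the cuts in V1 and in V2 are
    independent choices. *)
Lemma sum_cut_ofU V1 V2 (F G : {ffun T -> option X} -> rat) :
    stable (data_of K) V1 -> stable (data_of K) V2 -> [disjoint V1 & V2] ->
  \sum_(s | cut_of K (V1 :|: V2) s)
    F (restrict_cut V1 s) * G (restrict_cut V2 s) =
  (\sum_(s | cut_of K V1 s) F s) * (\sum_(s | cut_of K V2 s) G s).
Proof.
move=> s1 s2 dV; rewrite big_distrlr /= pair_big /=.
pose merge (p : {ffun T -> option X} * {ffun T -> option X}) :
  {ffun T -> option X} := [ffun k => if k \in V1 then p.1 k else p.2 k].
have cutN V s k : cut_of K V s -> k \notin V -> s k = None.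
  by move=> /cut_ofP/(_ k)[_]; case: (s k) => // x /(_ isT)->.
rewrite [RHS](reindex_onto
  (fun s => (restrict_cut V1 s, restrict_cut V2 s)) merge).
  apply: eq_bigl => s; apply/idP/andP => /= [sV|[/andP[c1 c2] /eqP <-]].
    split.
      apply/andP; split; apply/cut_ofP => k; rewrite !ffunE stable_edge //;
        have [sE _] := cut_ofP _ _ _ sV k; by case: ifP => // kV; rewrite sE.
    apply/eqP/ffunP => k; rewrite !ffunE /=.
    case: (boolP (k \in V1)) => // k1; case: (boolP (k \in V2)) => // k2.
    by apply/esym/(cutN _ _ _ sV); rewrite inE negb_or k1.
  apply/cut_ofP => k; rewrite [merge _ (edge K k)]ffunE [merge _ k]ffunE.
  rewrite stable_edge // inE.
  case: ifP => k1.
    by have [-> _] := cut_ofP _ _ _ c1 k.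
  by have [-> ?] := cut_ofP _ _ _ c2 k.
move=> [t1 t2] /andP[/= c1 c2]; congr pair; apply/ffunP => k; rewrite !ffunE /=.
  by case: (boolP (k \in V1)) => // k1; rewrite (cutN _ _ _ c1 k1).
case: (boolP (k \in V2)) => [k2|k2]; last by rewrite (cutN _ _ _ c2 k2).
by rewrite (disjointFl dV k2).
Qed.

End CutUnion.

Section HatBracketExp.
Variables (Y : Type) (C : gclass Y -> rat).
Hypotheses (C_fin : locally_finite C) (C_sub : substantial C)
  (C_conn : connected_series C).
Variables (T : finType) (K : utgraph void T).
Implicit Types V : {set T}.

Let C0 : C (to_class gempty) = 0 := connected_series0 C_conn.

(** The labels X are chosen before V, so that the same ones serve for two sets and for their
    union. *)
Lemma hat_bracket_exp_cut : exists (X : finType) (col : X -> Y), forall V,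
  hat (data_of K) (bracket (series_exp C)) V =
  \sum_(s | cut_of K V s) hat (cut col K s) (series_exp C) (cut_set s V).
Proof.
have Efin := locally_finite_exp C0 C_fin.
have [X [col [col_inj colE]]] := finite_colours (Efin (#|T|).*2).
exists X, col => V; apply: hat_bracket => //.
exact: substantial_exp.
Qed.

Lemma hat_bracket_exp_set0 :
  hat (data_of K) (bracket (series_exp C)) finset.set0 = 1.
Proof.
have [X [col ->]] := hat_bracket_exp_cut.
rewrite (big_pred1 [ffun=> None]) => [|s].
  suff -> : cut_set ([ffun=> None] : {ffun T -> option X}) finset.set0 =
      finset.set0 by exact: hat_exp_set0.
  by apply/setP => p; rewrite !inE.
apply/cut_ofP/eqP => [sP|-> k]; last by rewrite !ffunE.
apply/ffunP => k; rewrite ffunE; have [_] := sP k.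
by case: (s k) => // x /(_ isT); rewrite inE.
Qed.

Lemma hat_bracket_expU V1 V2 :
    stable (data_of K) V1 -> stable (data_of K) V2 -> [disjoint V1 & V2] ->
  hat (data_of K) (bracket (series_exp C)) (V1 :|: V2) =
  hat (data_of K) (bracket (series_exp C)) V1 *
  hat (data_of K) (bracket (series_exp C)) V2.
Proof.
have [X [col hE]] := hat_bracket_exp_cut => s1 s2 dV; rewrite !hE.
rewrite -sum_cut_ofU //; apply: eq_bigr => s sV; rewrite cut_setU.
rewrite hat_exp_sepU //; first by congr (_ * _); exact: hat_cut_restrict.
- exact: stable_cut_set sV s1.
- exact: stable_cut_set sV s2.
- rewrite disjoint_subset; apply/fintype.subsetP => p; rewrite !inE.
  by move=> /andP[/(disjointFr dV)->].
Qed.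

End HatBracketExp.

(** * Connected coefficients of the bracket of an exponential *)

Section ConnectedCoefficients.
Variables (Y : Type) (C : gclass Y -> rat).
Hypotheses (C_fin : locally_finite C) (C0 : C (to_class gempty) = 0).

(** Only classes with at most twice as many half-edges as B close up to B, and on these the
    exponential series stops before n. *)
Lemma bracket_exp_sum B n : ((nhalf (grepr B)).*2 < n)%N ->
  bracket (series_exp C) B =
  \sum_(j < n) j`!%:R^-1 * bracket (series_pow C j) B.
Proof.
move=> Bn; set N := (nhalf (grepr B)).*2 in Bn *.
(* One finite set that contains the relevant support of every power below n, and hence that of the
   exponential. *)
pose D := (\bigcup_(j in `I_n) size_support N (series_pow C j))%classic.
have Dfin : finite_set D.
  by apply: bigcup_finite => // j _; exact: locally_finite_pow.
have DN A : D A -> (nhalf (grepr A) <= N)%N by case=> j _ [].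
rewrite (bracketE (D := D)); last first.
  move=> A [AN]; rewrite (series_expE (n := n)) //; last first.
    exact: leq_ltn_trans Bn.
  move=> nz; apply: contrapT => nD; case/eqP: nz; apply: big1 => j _.
  have [->|fj] := eqVneq (series_pow C j A) 0; first by rewrite mulr0.
  by case: nD; rewrite /D /bigcup /=; exists (j : nat).
transitivity (\sum_(A \in D) \sum_(j < n)
    j`!%:R^-1 * (series_pow C j A * bracket_graph A B)).
  apply: eq_fsbigr => A; rewrite inE => /DN AN.
  rewrite (series_expE (n := n)) //; last exact: leq_ltn_trans Bn.
  by rewrite mulr_suml; apply: eq_bigr => j _; rewrite mulrA.
rewrite fsbig_finite // exchange_big /=; apply: eq_bigr => j _.
rewrite -mulr_sumr -fsbig_finite // -bracketE //.
by move=> A AS; rewrite /D /bigcup /=; exists (j : nat).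
Qed.

Lemma bracket_pow_eq0 B j : ((nhalf (grepr B)).*2 < j)%N ->
  bracket (series_pow C j) B = 0.
Proof.
move=> Bj; apply: fsbig1 => A _.
have [->|/nhalf_bracket_graph/andP[_ AB]] := eqVneq (bracket_graph A B) 0.
  by rewrite mulr0.
by rewrite series_pow_eq0 ?mul0r //; exact: leq_ltn_trans Bj.
Qed.

(** Closures of the empty graph are empty, and the empty graph is not connected. *)
Lemma bracket_one B : cconnected B -> bracket (@series_one Y) B = 0.
Proof.
move=> cB; apply: fsbig1 => A _.
have [->|/nhalf_bracket_graph/andP[BA _]] := eqVneq (bracket_graph A B) 0.
  by rewrite mulr0.
rewrite /series_one; have [AE|_] := eqVneq A (to_class gempty); last first.
  by rewrite mul0r.
case/andP: cB; rewrite card_ord lt0n -leqn0.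
by move: BA; rewrite AE nhalf_to_class card_void => ->.
Qed.

(** Power 0 vanishes at B by [bracket_one] and large powers by size, so the finite sum extends to
    all positive j. *)
Lemma bracket_exp_connected B : cconnected B ->
  bracket (series_exp C) B = \sum_(j \in [set j : nat | (0 < j)%N]%classic)
    j`!%:R^-1 * connected_part (bracket (series_pow C j)) B.
Proof.
move=> cB; set N := (nhalf (grepr B)).*2.
rewrite (bracket_exp_sum (ltnSn N)).
rewrite (fsbig_ord _ N.+1 (fun j => j`!%:R^-1 * bracket (series_pow C j) B)).
rewrite /connected_part cB.
transitivity (\sum_(j \in [set j : nat | (0 < j < N.+1)%N]%classic)
   j`!%:R^-1 * bracket (series_pow C j) B).
  apply/esym/fsbig_widen => [j /andP[]//|j [/= jN /negP]].
  rewrite jN andbT -eqn0Ngt => /eqP->.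
  by rewrite bracket_one ?mulr0.
apply: fsbig_widen => [j /andP[]//|j [/= j0 /negP]].
by rewrite j0 -leqNgt => Nj; rewrite bracket_pow_eq0 ?mulr0.
Qed.

End ConnectedCoefficients.

Local Open Scope classical_set_scope.
Local Open Scope ring_scope.

Theorem theorem2p1 (Y : Type) (C : gclass Y -> rat)
    (C_series : is_series C) (C_substantial : substantial C)
    (C_connected : connected_series C) :
  bracket (series_exp C) =
  series_exp (fun K : gclass void =>
    \sum_(j \in [set j : nat | (0 < j)%N])
      (j`!%:R)^-1 * connected_part (bracket (series_pow C j)) K).
Proof.
set c := (X in _ = series_exp X).
have C_fin := series_locally_finite C_series.
have C0 := connected_series0 C_connected.
have c_conn : connected_series c.
  move=> B; apply: contraNT => nB; rewrite /c fsbig1 // => j _.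
  by rewrite /connected_part (negPf nB) mulr0.
have c0 := connected_series0 c_conn.
apply: hat_inj => T K.
have : stable (data_of K) [set: T]%SET by apply/stableP => t; rewrite !inE.
(* Both sides are 1 on the empty set and multiplicative over disjoint stable sets, so only single
   components have to be compared. *)
move: [set: T]%SET; apply: stable_ind => [|V Virr|U V sU sV dUV IU IV].
- by rewrite hat_bracket_exp_set0 // hat_exp_set0.
(* On a component [series_exp c] agrees with [c], and a class B that embeds onto it is connected,
   where the bracket has coefficient [c B]. *)
- rewrite hat_irreducible_exp //.
  case: (hat_cases (data_of K) V) => [[B NB hE]|[_ h0]]; last by rewrite !h0.
  rewrite !hE bracket_exp_connected //.
  exact: irreducible_connected Virr NB.
- by rewrite hat_bracket_expU // hat_exp_sepU // IU IV.
Qed.
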